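(* Let $A$ be a quasi-category and $t$ a vertex of $A$. Then $t$ is terminal in Joyal's sense (every sphere $\partial\Delta^n\to A$, $n\ge1$, whose final vertex is $t$ extends along $\partial\Delta^n\hookrightarrow\Delta^n$) if and only if $t\colon\Delta^0\to A$ is right adjoint to the unique functor $!\colon A\to\Delta^0$, i.e. ${!}\dashv t$ is an adjunction of quasi-categories.
   Context: A quasi-category is a simplicial set with fillers for all inner horns; functors are simplicial maps between quasi-categories. $\mathrm{qCat}_2$ is the strict 2-category of quasi-categories with hom-categories $\hom'(A,B)=h(B^A)$, where $B^A$ is the internal hom and $h\colon\mathrm{sSet}\to\mathrm{Cat}$ is left adjoint to the nerve. An adjunction of quasi-categories is an adjunction in $\mathrm{qCat}_2$ (1-cells with unit and counit 2-cells satisfying the triangle identities). *)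

(* Defs.v *)
From mathcomp Require Import all_boot.
From mathcomp Require Import boolp.

Set Implicit Arguments.
Unset Strict Implicit.
Unset Printing Implicit Defensive.

Local Obligation Tactic := idtac.

(** * Categories and functors *)

(* Composition is written in diagrammatic order: [f ;; g] is [f], then [g].   *)
Record category := Category {
  ob :> Type;
  hom : ob -> ob -> Type;
  idm : forall x, hom x x;
  compm : forall x y z, hom x y -> hom y z -> hom x z;
  comp1m : forall x y (f : hom x y), compm (idm x) f = f;
  compm1 : forall x y (f : hom x y), compm f (idm y) = f;
  compmA : forall x y z t (f : hom x y) (g : hom y z) (k : hom z t),
    compm f (compm g k) = compm (compm f g) k }.

Arguments idm {c} x.
Arguments compm {c x y z} f g.

Declare Scope cat_scope.
Delimit Scope cat_scope with cat.
Notation "f ;; g" := (compm f g) (at level 50, left associativity) : cat_scope.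
Local Open Scope cat_scope.

(* The identity of [x], seen as a morphism to an equal object.                *)
Definition eq_hom (C : category) (x y : C) (e : x = y) : hom x y :=
  match e in _ = z return hom x z with erefl => idm x end.

Record functor (C D : category) := Functor {
  fob :> C -> D;
  fmap : forall x y, hom x y -> hom (fob x) (fob y);
  fmap1 : forall x, fmap (idm x) = idm (fob x);
  fmapM : forall x y z (f : hom x y) (g : hom y z),
    fmap (f ;; g) = fmap f ;; fmap g }.

Arguments fmap {C D} _ {x y} _.

Definition arrow (C : category) := {x : C & {y : C & hom x y}}.
Definition pack (C : category) (x y : C) (f : hom x y) : arrow C :=
  existT _ x (existT _ y f).

Lemma existT_inj (T : Type) (P : T -> Type) (x : T) (u v : P x) :
  existT P x u = existT P x v -> u = v.
Proof.
by move=> e; have := projT2_eq e; rewrite (Prop_irrelevance (projT1_eq e) erefl).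
Qed.

Lemma pack_inj (C : category) (x y : C) (f g : hom x y) : pack f = pack g -> f = g.
Proof. by move=> fg; apply: existT_inj (existT_inj fg). Qed.

Lemma pack_src (C : category) (x y x' y' : C) (f : hom x y) (g : hom x' y') :
  pack f = pack g -> x = x'.
Proof. by case. Qed.

Lemma pack_tgt (C : category) (x y x' y' : C) (f : hom x y) (g : hom x' y') :
  pack f = pack g -> y = y'.
Proof. by move/(congr1 (fun a : arrow C => projT1 (projT2 a))). Qed.

Lemma pack_compm (C : category) (x y z x' y' z' : C) (f : hom x y) (g : hom y z)
    (f' : hom x' y') (g' : hom y' z') :
  pack f = pack f' -> pack g = pack g' -> pack (f ;; g) = pack (f' ;; g').
Proof.
move=> ef eg; move: (pack_src ef) (pack_tgt ef) (pack_tgt eg) => ex ey ez.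
by subst; rewrite (pack_inj ef) (pack_inj eg).
Qed.

Lemma pack_idm (C : category) (x x' : C) : x = x' -> pack (idm x) = pack (idm x').
Proof. by move->. Qed.

Lemma functor_ext (C D : category) (F G : functor C D) :
  (forall x y (f : hom x y), pack (fmap F f) = pack (fmap G f)) -> F = G.
Proof.
case: F G => F0 F1 F2 F3 [G0 G1 G2 G3] /= FG.
have e0 : F0 = G0 by apply: funext => x; apply: pack_src (FG x x (idm x)).
subst G0; have e1 : F1 = G1.
  apply: functional_extensionality_dep => x; apply: functional_extensionality_dep => y.
  by apply: funext => f; apply: pack_inj; apply: FG.
by subst G1; rewrite (Prop_irrelevance F2 G2) (Prop_irrelevance F3 G3).
Qed.

Definition fid (C : category) : functor C C := @Functor C C id (fun _ _ f => f)
  (fun _ => erefl) (fun _ _ _ _ _ => erefl).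

(* Diagrammatic order again: first [F], then [G].                             *)
Program Definition fcomp (C D E : category) (F : functor C D) (G : functor D E) :
    functor C E :=
  @Functor C E (fun x => G (F x)) (fun _ _ f => fmap G (fmap F f)) _ _.
Next Obligation. by move=> C D E F G x /=; rewrite !fmap1. Qed.
Next Obligation. by move=> C D E F G x y z f g /=; rewrite !fmapM. Qed.

Lemma fmap_fcomp (C D E : category) (F : functor C D) (G : functor D E) (x y : C) (f : hom x y) :
  fmap (fcomp F G) f = fmap G (fmap F f).
Proof. by []. Qed.
Lemma fcompA (C D E H : category) (F : functor C D) (G : functor D E) (K : functor E H) :
  fcomp F (fcomp G K) = fcomp (fcomp F G) K.
Proof. exact: functor_ext. Qed.
Lemma fcomp1f (C D : category) (F : functor C D) : fcomp (fid C) F = F.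
Proof. exact: functor_ext. Qed.
Lemma fcompf1 (C D : category) (F : functor C D) : fcomp F (fid D) = F.
Proof. exact: functor_ext. Qed.

Program Definition prodcat (C D : category) : category :=
  @Category (C * D)%type (fun a b => (hom a.1 b.1 * hom a.2 b.2)%type)
    (fun a => (idm a.1, idm a.2)) (fun _ _ _ f g => (f.1 ;; g.1, f.2 ;; g.2)) _ _ _.
Next Obligation. by move=> C D x y [f g] /=; rewrite !comp1m. Qed.
Next Obligation. by move=> C D x y [f g] /=; rewrite !compm1. Qed.
Next Obligation. by move=> C D x y z t f g k /=; rewrite !compmA. Qed.

Program Definition fconst (C D : category) (d : D) : functor C D :=
  @Functor C D (fun _ => d) (fun _ _ _ => idm d) _ _.
Next Obligation. by []. Qed.
Next Obligation. by move=> *; rewrite /= comp1m. Qed.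

Program Definition fpair (C D E : category) (F : functor C D) (G : functor C E) :
    functor C (prodcat D E) :=
  @Functor C (prodcat D E) (fun x => (F x, G x)) (fun _ _ f => (fmap F f, fmap G f)) _ _.
Next Obligation. by move=> *; rewrite /= !fmap1. Qed.
Next Obligation. by move=> *; rewrite /= !fmapM. Qed.

Program Definition fprod (C D C' D' : category) (F : functor C C') (G : functor D D') :
    functor (prodcat C D) (prodcat C' D') :=
  @Functor (prodcat C D) (prodcat C' D') (fun a => (F a.1, G a.2))
    (fun _ _ f => (fmap F f.1, fmap G f.2)) _ _.
Next Obligation. by move=> *; rewrite /= !fmap1. Qed.
Next Obligation. by move=> *; rewrite /= !fmapM. Qed.

Definition fassoc (C D E : category) :
    functor (prodcat (prodcat C D) E) (prodcat C (prodcat D E)) :=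
  @Functor (prodcat (prodcat C D) E) (prodcat C (prodcat D E))
    (fun a => (a.1.1, (a.1.2, a.2))) (fun _ _ f => (f.1.1, (f.1.2, f.2)))
    (fun _ => erefl) (fun _ _ _ _ _ => erefl).

Lemma fcomp_fpair (C D E E' : category) (F : functor C D) (G : functor D E) (G' : functor D E') :
  fcomp F (fpair G G') = fpair (fcomp F G) (fcomp F G').
Proof. exact: functor_ext. Qed.
Lemma fpair_fprod (C D E D' E' : category) (F : functor C D) (G : functor C E)
    (F' : functor D D') (G' : functor E E') :
  fcomp (fpair F G) (fprod F' G') = fpair (fcomp F F') (fcomp G G').
Proof. exact: functor_ext. Qed.
Lemma fprod_fprod (C D C' D' C'' D'' : category) (F : functor C C') (G : functor D D')
    (F' : functor C' C'') (G' : functor D' D'') :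
  fcomp (fprod F G) (fprod F' G') = fprod (fcomp F F') (fcomp G G').
Proof. exact: functor_ext. Qed.

Lemma fprod1 (C D : category) : fprod (fid C) (fid D) = fid (prodcat C D).
Proof. by apply: functor_ext => [[x y] [x' y'] [f g]]. Qed.

Lemma fpair_fassoc (C D D' D'' : category) (F : functor C D) (G : functor C D')
    (H : functor C D'') :
  fcomp (fpair (fpair F G) H) (fassoc D D' D'') = fpair F (fpair G H).
Proof. exact: functor_ext. Qed.

(** * Strict 2-categories and adjunctions in them *)

(* A strict 2-category is a category enriched over (Cat, x).  The composite   *)
(* of [f : cell1 A B] and [g : cell1 B C] is [comp1 A B C (g, f)].             *)
Record strict2cat := Strict2cat {
  cell0 :> Type;
  cell1 : cell0 -> cell0 -> category;
  id1 : forall A, cell1 A A;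
  comp1 : forall A B C, functor (prodcat (cell1 B C) (cell1 A B)) (cell1 A C);
  comp1A : forall A B C D,
    fcomp (fassoc (cell1 C D) (cell1 B C) (cell1 A B))
          (fcomp (fprod (fid _) (comp1 A B C)) (comp1 A C D))
    = fcomp (fprod (comp1 B C D) (fid _)) (comp1 A B D);
  comp1_1f : forall A B,
    fcomp (fpair (fconst (cell1 A B) (id1 B)) (fid _)) (comp1 A B B) = fid _;
  comp1_f1 : forall A B,
    fcomp (fpair (fid _) (fconst (cell1 A B) (id1 A))) (comp1 A A B) = fid _ }.

Section TwoCategory.
Variable K : strict2cat.

Definition comp1_ob (A B C : K) (g : cell1 B C) (f : cell1 A B) : cell1 A C :=
  comp1 A B C (g, f).
Local Notation "g \o1 f" := (comp1_ob g f) (at level 40, left associativity).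

Definition hcomp2 (A B C : K) (g g' : cell1 B C) (f f' : cell1 A B)
    (b : hom g g') (a : hom f f') : hom (g \o1 f) (g' \o1 f') :=
  fmap (comp1 A B C) ((b, a) : @hom (prodcat _ _) (g, f) (g', f')).

Definition whiskl (A B C : K) (g : cell1 B C) (f f' : cell1 A B) (a : hom f f') :
  hom (g \o1 f) (g \o1 f') := hcomp2 (idm g) a.
Definition whiskr (A B C : K) (g g' : cell1 B C) (b : hom g g') (f : cell1 A B) :
  hom (g \o1 f) (g' \o1 f) := hcomp2 b (idm f).

Lemma comp1_obA (A B C D : K) (k : cell1 C D) (g : cell1 B C) (f : cell1 A B) :
  k \o1 (g \o1 f) = k \o1 g \o1 f.
Proof.
exact: (congr1 (fun F : functor (prodcat (prodcat (cell1 C D) (cell1 B C)) (cell1 A B)) _ =>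
  F ((k, g), f)) (comp1A A B C D)).
Qed.
Lemma comp1_ob1f (A B : K) (f : cell1 A B) : id1 B \o1 f = f.
Proof. exact: (congr1 (fun F : functor (cell1 A B) _ => F f) (comp1_1f A B)). Qed.
Lemma comp1_obf1 (A B : K) (f : cell1 A B) : f \o1 id1 A = f.
Proof. exact: (congr1 (fun F : functor (cell1 A B) _ => F f) (comp1_f1 A B)). Qed.

(* [f] is left adjoint to [u].  The strict associativity and unit laws enter  *)
(* the triangle identities as the identity 2-cells [eq_hom].                  *)
Definition adjunction (A B : K) (f : cell1 A B) (u : cell1 B A) : Prop :=
  exists (eta : hom (id1 A) (u \o1 f)) (eps : hom (f \o1 u) (id1 B)),
    eq_hom (esym (comp1_obf1 f)) ;; whiskl f eta ;; eq_hom (comp1_obA f u f)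
      ;; whiskr eps f ;; eq_hom (comp1_ob1f f) = idm f
    /\ eq_hom (esym (comp1_ob1f u)) ;; whiskr eta u ;; eq_hom (esym (comp1_obA u f u))
      ;; whiskl u eps ;; eq_hom (comp1_obf1 u) = idm u.
End TwoCategory.

(** * Simplicial sets *)

(* Morphisms [m] -> [n] of the simplex category, [n] being {0 < ... < n}.     *)
Record ordmap (m n : nat) := OrdMap {
  ordfun :> 'I_m.+1 -> 'I_n.+1;
  ordfun_mono : forall i j : 'I_m.+1, i <= j -> ordfun i <= ordfun j }.

Lemma ordmap_ext (m n : nat) (f g : ordmap m n) : f =1 g -> f = g.
Proof.
case: f g => f f_mono [g g_mono] /= /funext fg; subst g.
by rewrite (Prop_irrelevance f_mono g_mono).
Qed.

Lemma om0_eq (m : nat) (f g : ordmap m 0) : f = g.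
Proof. by apply: ordmap_ext => i; rewrite [RHS]ord1 ord1. Qed.

Definition om_id (n : nat) : ordmap n n := @OrdMap n n id (fun _ _ ij => ij).
Definition om_comp (m n p : nat) (g : ordmap n p) (f : ordmap m n) : ordmap m p :=
  @OrdMap m p (fun i => g (f i)) (fun _ _ ij => ordfun_mono g (ordfun_mono f ij)).
Definition om_const (m n : nat) (i : 'I_n.+1) : ordmap m n :=
  @OrdMap m n (fun _ => i) (fun _ _ _ => leqnn i).

Program Definition coface (n : nat) (i : 'I_n.+2) : ordmap n n.+1 :=
  @OrdMap n n.+1 (lift i) _.
Next Obligation. by move=> n i j k jk; rewrite /= leq_bump2. Qed.

Record sSet := SSet {
  simplex :> nat -> Type;
  act : forall m n, ordmap m n -> simplex n -> simplex m;
  act_id : forall n (x : simplex n), act (om_id n) x = x;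
  act_comp : forall m n p (g : ordmap n p) (f : ordmap m n) (x : simplex p),
    act (om_comp g f) x = act f (act g x) }.

Record smap (X Y : sSet) := SMap {
  sapp :> forall n, X n -> Y n;
  sapp_act : forall m n (f : ordmap m n) (x : X n), sapp (act f x) = act f (sapp x) }.

Arguments sapp {X Y} _ {n} _.

Lemma smap_ext (X Y : sSet) (f g : smap X Y) : (forall n (x : X n), f n x = g n x) -> f = g.
Proof.
case: f g => f f_act [g g_act] /= fg.
have e : f = g.
  by apply: functional_extensionality_dep => n; apply: funext => x; apply: fg.
by subst g; rewrite (Prop_irrelevance f_act g_act).
Qed.

Definition sid (X : sSet) : smap X X := @SMap X X (fun _ x => x) (fun _ _ _ _ => erefl).
Program Definition scomp (X Y Z : sSet) (f : smap X Y) (g : smap Y Z) : smap X Z :=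
  @SMap X Z (fun n x => g n (f n x)) _.
Next Obligation. by move=> *; rewrite /= !sapp_act. Qed.

Program Definition sprod (X Y : sSet) : sSet :=
  @SSet (fun n => X n * Y n)%type (fun _ _ f x => (act f x.1, act f x.2)) _ _.
Next Obligation. by move=> X Y n [x y] /=; rewrite !act_id. Qed.
Next Obligation. by move=> *; rewrite /= !act_comp. Qed.

Definition sfst (X Y : sSet) : smap (sprod X Y) X :=
  @SMap (sprod X Y) X (fun _ x => x.1) (fun _ _ _ _ => erefl).
Definition ssnd (X Y : sSet) : smap (sprod X Y) Y :=
  @SMap (sprod X Y) Y (fun _ x => x.2) (fun _ _ _ _ => erefl).

Program Definition sprodmap (X Y X' Y' : sSet) (f : smap X X') (g : smap Y Y') :
    smap (sprod X Y) (sprod X' Y') :=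
  @SMap (sprod X Y) (sprod X' Y') (fun n x => (f n x.1, g n x.2)) _.
Next Obligation. by move=> *; rewrite /= !sapp_act. Qed.

Definition sassoc (X Y Z : sSet) : smap (sprod (sprod X Y) Z) (sprod X (sprod Y Z)) :=
  @SMap (sprod (sprod X Y) Z) (sprod X (sprod Y Z))
    (fun _ x => (x.1.1, (x.1.2, x.2))) (fun _ _ _ _ => erefl).

Program Definition Delta (n : nat) : sSet :=
  @SSet (fun m => ordmap m n) (fun _ _ f s => om_comp s f) _ _.
Next Obligation. by move=> n m s; apply: ordmap_ext. Qed.
Next Obligation. by move=> *; apply: ordmap_ext. Qed.

Program Definition Delta_map (m n : nat) (f : ordmap m n) : smap (Delta m) (Delta n) :=
  @SMap (Delta m) (Delta n) (fun _ s => om_comp f s) _.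
Next Obligation. by move=> *; apply: ordmap_ext. Qed.

(* The map Delta^n -> X classifying an n-simplex of X.                        *)
Program Definition yoneda (X : sSet) (n : nat) (x : X n) : smap (Delta n) X :=
  @SMap (Delta n) X (fun _ s => act s x) _.
Next Obligation. by move=> *; rewrite /= act_comp. Qed.

Program Definition bang (X : sSet) : smap X (Delta 0) :=
  @SMap X (Delta 0) (fun n _ => om_const n ord0) _.
Next Obligation. by move=> *; apply: ordmap_ext. Qed.

Lemma bang_unique (X : sSet) (f : smap X (Delta 0)) : f = bang X.
Proof. by apply: smap_ext => n x; apply: om0_eq. Qed.

Section Subcomplex.
Variables (X : sSet) (P : forall n, X n -> Prop).
Hypothesis P_act : forall m n (f : ordmap m n) (x : X n), P x -> P (act f x).

Program Definition subcomplex : sSet :=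
  @SSet (fun n => {x : X n | P x})
    (fun _ _ f x => exist _ (act f (sval x)) (P_act f (proj2_sig x))) _ _.
Next Obligation. by move=> n [x Px]; apply: eq_exist => /=; rewrite act_id. Qed.
Next Obligation. by move=> *; apply: eq_exist => /=; rewrite act_comp. Qed.

Definition sincl : smap subcomplex X :=
  @SMap subcomplex X (fun _ x => sval x) (fun _ _ _ _ => erefl).
End Subcomplex.

Definition in_boundary (n m : nat) (s : Delta n m) : Prop :=
  exists i : 'I_n.+1, forall j, s j <> i.
Definition in_horn (n : nat) (k : 'I_n.+1) (m : nat) (s : Delta n m) : Prop :=
  exists2 i : 'I_n.+1, i <> k & forall j, s j <> i.

Lemma in_boundary_act (n m p : nat) (f : ordmap m p) (s : Delta n p) :
  in_boundary s -> in_boundary (act f s).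
Proof. by case=> i si; exists i => j; apply: si. Qed.
Lemma in_horn_act (n : nat) (k : 'I_n.+1) (m p : nat) (f : ordmap m p) (s : Delta n p) :
  in_horn k s -> in_horn k (act f s).
Proof. by case=> i ik si; exists i => // j; apply: si. Qed.

Definition boundary (n : nat) : sSet := subcomplex (@in_boundary_act n).
Definition boundary_incl (n : nat) : smap (boundary n) (Delta n) := sincl (@in_boundary_act n).
Definition horn (n : nat) (k : 'I_n.+1) : sSet := subcomplex (@in_horn_act n k).
Definition horn_incl (n : nat) (k : 'I_n.+1) : smap (horn k) (Delta n) :=
  sincl (@in_horn_act n k).

Lemma in_boundary_vertex (n : nat) (n_gt0 : 0 < n) (i : 'I_n.+1) :
  in_boundary (om_const 0 i : Delta n 0).
Proof.
case: n n_gt0 i => // n _ i; exists (lift i ord0) => _ /= e.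
by have := neq_lift i ord0; rewrite -e eqxx.
Qed.
Definition boundary_vertex (n : nat) (n_gt0 : 0 < n) (i : 'I_n.+1) : boundary n 0 :=
  exist _ (om_const 0 i : Delta n 0) (in_boundary_vertex n_gt0 i).

Definition extends (X Y Z : sSet) (i : smap Y Z) (f : smap Y X) : Prop :=
  exists g : smap Z X, scomp i g = f.

Definition is_quasicategory (X : sSet) : Prop :=
  forall (n : nat) (k : 'I_n.+1), 0 < k < n ->
  forall f : smap (horn k) X, extends (horn_incl k) f.

Definition joyal_terminal (A : sSet) (t : A 0) : Prop :=
  forall (n : nat) (n_gt0 : 0 < n) (f : smap (boundary n) A),
  f 0 (boundary_vertex n_gt0 ord_max) = t -> extends (boundary_incl n) f.

(* The internal hom B^A, with n-simplices the maps A x Delta^n -> B.          *)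
Program Definition sexp (B A : sSet) : sSet :=
  @SSet (fun n => smap (sprod A (Delta n)) B)
    (fun _ _ f x => scomp (sprodmap (sid A) (Delta_map f)) x) _ _.
Next Obligation.
by move=> B A n x; apply: smap_ext => m [a s] /=; congr (x _ (_, _)); apply: ordmap_ext.
Qed.
Next Obligation.
by move=> B A m n p g f x; apply: smap_ext => q [a s] /=; congr (x _ (_, _)); apply: ordmap_ext.
Qed.

(* The vertex of B^A naming a map A -> B; by [sname_bij], every vertex is one. *)
Definition sname (A B : sSet) (f : smap A B) : sexp B A 0 := scomp (sfst A (Delta 0)) f.

(* The simplicially enriched composition C^B x B^A -> C^A.                    *)
Program Definition sexp_comp (A B C : sSet) :
    smap (sprod (sexp C B) (sexp B A)) (sexp C A) :=
  @SMap (sprod (sexp C B) (sexp B A)) (sexp C A)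
    (fun n x => @SMap (sprod A (Delta n)) C (fun m y => x.1 m (x.2 m y, y.2)) _) _.
Next Obligation.
move=> A B C n x m p f y; rewrite -(sapp_act x.1); congr (x.1 _ (_, _)).
exact: (sapp_act x.2 f y).
Qed.
Next Obligation. by move=> *; apply: smap_ext. Qed.

Lemma sname_bij (A B : sSet) : bijective (@sname A B).
Proof.
pose u : smap A (sprod A (Delta 0)) :=
  @SMap A (sprod A (Delta 0)) (fun n a => (a, om_const n ord0)) (fun m n f a =>
    congr1 (pair _) (om0_eq _ _)).
exists (scomp u) => [f|x]; first exact: smap_ext.
by apply: smap_ext => n [a s] /=; congr (x _ (_, _)); apply: om0_eq.
Qed.
Lemma sname_comp (A B C : sSet) (f : smap A B) (g : smap B C) :
  sexp_comp A B C 0 (sname g, sname f) = sname (scomp f g).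
Proof. exact: smap_ext. Qed.

(** * The nerve *)

Program Definition ordcat (n : nat) : category :=
  @Category 'I_n.+1 (fun i j => i <= j) (fun i => leqnn i) (fun _ _ _ => @leq_trans _ _ _)
    _ _ _.
Next Obligation. by move=> *; apply: eq_irrelevance. Qed.
Next Obligation. by move=> *; apply: eq_irrelevance. Qed.
Next Obligation. by move=> *; apply: eq_irrelevance. Qed.

Program Definition ordfunctor (m n : nat) (f : ordmap m n) : functor (ordcat m) (ordcat n) :=
  @Functor (ordcat m) (ordcat n) f (@ordfun_mono m n f) _ _.
Next Obligation. by move=> *; apply: eq_irrelevance. Qed.
Next Obligation. by move=> *; apply: eq_irrelevance. Qed.

Lemma pack_ordcat (n : nat) (C : category) (F : functor (ordcat n) C)
    (i j i' j' : ordcat n) (p : hom i j) (p' : hom i' j') :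
  i = i' -> j = j' -> pack (fmap F p) = pack (fmap F p').
Proof. by move=> ei ej; subst; rewrite (eq_irrelevance p p'). Qed.

Program Definition nerve (C : category) : sSet :=
  @SSet (fun n => functor (ordcat n) C) (fun _ _ f F => fcomp (ordfunctor f) F) _ _.
Next Obligation. by move=> C n F; apply: functor_ext => i j ij; apply: pack_ordcat. Qed.
Next Obligation. by move=> C m n p g f F; apply: functor_ext => i j ij; apply: pack_ordcat. Qed.

Program Definition nerve_map (C D : category) (F : functor C D) : smap (nerve C) (nerve D) :=
  @SMap (nerve C) (nerve D) (fun n G => fcomp G F) _.
Next Obligation. by move=> *; rewrite /= fcompA. Qed.

(** * The left adjoint of the nerve *)

Definition face (X : sSet) (n : nat) (i : 'I_n.+2) : X n.+1 -> X n := act (coface i).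
Definition degen0 (X : sSet) : X 0 -> X 1 := act (om_const 1 ord0).
Arguments face {X n} i x.
Arguments degen0 {X} x.

Definition ord1_2 : 'I_3 := Ordinal (isT : 1 < 3).

(* Edges from x to y: d_1 is the source, d_0 the target.                      *)
Definition edge (X : sSet) (x y : X 0) := {e : X 1 | face ord_max e = x /\ face ord0 e = y}.

(* [h X] is presented by generators and relations: the objects are the        *)
(* vertices, the morphisms are freely generated by the edges, subject to      *)
(* [s_0 x = 1_x] and to [d_2 s ;; d_0 s = d_1 s] for every 2-simplex [s].      *)
(* By [h_left_adjoint] and [hunit_natural] below, h is left adjoint to nerve. *)
Inductive hterm (X : sSet) : X 0 -> X 0 -> Type :=
| HGen x y : edge x y -> hterm x y
| HId x : hterm x x
| HComp x y z : hterm x y -> hterm y z -> hterm x z.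
Arguments HId {X} x.

Inductive hrel (X : sSet) : forall x y : X 0, hterm x y -> hterm x y -> Prop :=
| HDegen (x : X 0) (e : edge x x) : sval e = degen0 x -> hrel (HGen e) (HId x)
| HTriangle (s : X 2) x y z (e : edge x y) (f : edge y z) (g : edge x z) :
    sval e = face ord_max s -> sval f = face ord0 s -> sval g = face ord1_2 s ->
    hrel (HComp (HGen e) (HGen f)) (HGen g)
| HIdl x y (p : hterm x y) : hrel (HComp (HId x) p) p
| HIdr x y (p : hterm x y) : hrel (HComp p (HId y)) p
| HAssoc x y z t (p : hterm x y) (q : hterm y z) (r : hterm z t) :
    hrel (HComp p (HComp q r)) (HComp (HComp p q) r)
| HCongr x y z (p p' : hterm x y) (q q' : hterm y z) :
    hrel p p' -> hrel q q' -> hrel (HComp p q) (HComp p' q')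
| HRefl x y (p : hterm x y) : hrel p p
| HSym x y (p q : hterm x y) : hrel p q -> hrel q p
| HTrans x y (p q r : hterm x y) : hrel p q -> hrel q r -> hrel p r.

Section HHom.
Variables (X : sSet) (x y : X 0).
Local Open Scope quotient_scope.

Definition hrelb : rel {classic (hterm x y)} := fun p q => `[< hrel p q >].
Lemma hrelb_refl : reflexive hrelb. Proof. by move=> p; apply/asboolP/HRefl. Qed.
Lemma hrelb_sym : symmetric hrelb.
Proof. by move=> p q; apply/idP/idP => /asboolP pq; apply/asboolP/HSym. Qed.
Lemma hrelb_trans : transitive hrelb.
Proof. by move=> q p r /asboolP pq /asboolP qr; apply/asboolP/(HTrans pq). Qed.
Canonical hrelb_equiv := EquivRel hrelb hrelb_refl hrelb_sym hrelb_trans.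

Definition hhom := {eq_quot hrelb_equiv}.
Definition hclass (p : hterm x y) : hhom := \pi_hhom (p : {classic (hterm x y)}).
Definition hrepr (c : hhom) : hterm x y := repr c.

Lemma hreprK c : hclass (hrepr c) = c. Proof. exact: reprK. Qed.
Lemma hclassP p q : hclass p = hclass q <-> hrel p q.
Proof. by split=> [/eqmodP/asboolP | pq] //; apply/eqmodP/asboolP. Qed.
Lemma hrepr_class p : hrel (hrepr (hclass p)) p. Proof. by apply/hclassP/hreprK. Qed.
Lemma hhom_ind (P : hhom -> Prop) : (forall p, P (hclass p)) -> forall c, P c.
Proof. by move=> Pp c; rewrite -(hreprK c). Qed.
End HHom.

Program Definition h (X : sSet) : category :=
  @Category (X 0) (@hhom X) (fun x => hclass (HId x))
    (fun x y z a b => hclass (HComp (hrepr a) (hrepr b))) _ _ _.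
Next Obligation.
move=> X x y; elim/hhom_ind => p; apply/hclassP; apply: HTrans (HIdl _).
by apply: HCongr; apply: hrepr_class.
Qed.
Next Obligation.
move=> X x y; elim/hhom_ind => p; apply/hclassP; apply: HTrans (HIdr _).
by apply: HCongr; apply: hrepr_class.
Qed.
Next Obligation.
move=> X x y z t a b c; apply/hclassP.
apply: HTrans (HTrans (HAssoc (hrepr a) (hrepr b) (hrepr c)) _).
  by apply: HCongr (HRefl _) (hrepr_class _).
by apply: HSym; apply: HCongr (hrepr_class _) (HRefl _).
Qed.

Lemma hclassM (X : sSet) (x y z : X 0) (p : hterm x y) (q : hterm y z) :
  (hclass p : @hom (h X) _ _) ;; hclass q = hclass (HComp p q).
Proof. by apply/hclassP; apply: HCongr; apply: hrepr_class. Qed.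

Lemma pack_gen (X : sSet) (x y x' y' : X 0) (e : edge x y) (e' : edge x' y') :
  sval e = sval e' ->
  @pack (h X) x y (hclass (HGen e)) = @pack (h X) x' y' (hclass (HGen e')).
Proof.
case: e e' => e [ex ey] [e' [ex' ey']] /= ee; by subst.
Qed.

Lemma face_degen0 (X : sSet) (i : 'I_2) (x : X 0) : face i (degen0 x) = x.
Proof. by rewrite /face /degen0 -act_comp -[RHS]act_id; congr act; apply: om0_eq. Qed.

Definition edge_degen (X : sSet) (x : X 0) : edge x x :=
  exist _ (degen0 x) (conj (face_degen0 _ x) (face_degen0 _ x)).

Section HFunctor.
Variables (X : sSet) (C : category) (F0 : X 0 -> C).
Variable (F1 : forall x y : X 0, edge x y -> hom (F0 x) (F0 y)).

Fixpoint hterm_eval (x y : X 0) (p : hterm x y) : hom (F0 x) (F0 y) :=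
  match p with
  | HGen _ _ e => F1 e
  | HId x => idm (F0 x)
  | HComp _ _ _ p q => hterm_eval p ;; hterm_eval q
  end.

Hypothesis F_degen : forall (x : X 0) (e : edge x x), sval e = degen0 x -> F1 e = idm (F0 x).
Hypothesis F_triangle : forall (s : X 2) x y z (e : edge x y) (f : edge y z) (g : edge x z),
  sval e = face ord_max s -> sval f = face ord0 s -> sval g = face ord1_2 s ->
  F1 e ;; F1 f = F1 g.

Lemma hterm_eval_rel (x y : X 0) (p q : hterm x y) :
  hrel p q -> hterm_eval p = hterm_eval q.
Proof.
elim=> {x y p q} /=.
- exact: F_degen.
- exact: F_triangle.
- by move=> *; rewrite comp1m.
- by move=> *; rewrite compm1.
- by move=> *; rewrite compmA.
- by move=> x y z p p' q q' _ -> _ ->.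
- by [].
- by [].
- by move=> x y p q r _ -> _ ->.
Qed.

Program Definition hfunctor : functor (h X) C :=
  @Functor (h X) C F0 (fun x y c => hterm_eval (hrepr c)) _ _.
Next Obligation. by move=> x /=; rewrite (hterm_eval_rel (hrepr_class _)). Qed.
Next Obligation. by move=> x y z a b /=; rewrite (hterm_eval_rel (hrepr_class _)). Qed.

Lemma hfunctorE (x y : X 0) (p : hterm x y) :
  @fmap _ _ hfunctor x y (hclass p) = hterm_eval p.
Proof. exact: (hterm_eval_rel (hrepr_class p)). Qed.
End HFunctor.

Lemma hfunctor_ext (X : sSet) (C : category) (F G : functor (h X) C) :
  (forall (x y : X 0) (e : edge x y),
     pack (@fmap _ _ F x y (hclass (HGen e))) = pack (@fmap _ _ G x y (hclass (HGen e)))) ->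
  F = G.
Proof.
move=> FG; apply: functor_ext => x y; elim/hhom_ind; elim=> {x y}.
- exact: FG.
- move=> x; have /= -> := fmap1 F x; have /= -> := fmap1 G x; apply: pack_idm.
  exact: pack_src (FG x x (edge_degen x)).
- by move=> x y z p IHp q IHq; rewrite -hclassM !fmapM; apply: pack_compm.
Qed.

Section HMap.
Variables (X Y : sSet) (f : smap X Y).

Program Definition edge_map (x y : X 0) (e : edge x y) : edge (f 0 x) (f 0 y) :=
  exist _ (f 1 (sval e)) _.
Next Obligation. by move=> x y e; case: (proj2_sig e) => ex ey; split; rewrite /face -sapp_act -/(face _ _) ?ex ?ey. Qed.

Program Definition hmap : functor (h X) (h Y) :=
  @hfunctor X (h Y) (f 0) (fun x y e => hclass (HGen (edge_map e))) _ _.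
Next Obligation. by move=> x e ex; apply/hclassP/HDegen; rewrite /= ex /degen0 sapp_act. Qed.
Next Obligation.
move=> s x y z e1 e2 e3 es1 es2 es3; rewrite hclassM; apply/hclassP.
by apply: (@HTriangle _ (f 2 s)); rewrite /= ?es1 ?es2 ?es3 /face sapp_act.
Qed.

Lemma hmap_gen (x y : X 0) (e : edge x y) :
  @fmap _ _ hmap x y (hclass (HGen e)) = hclass (HGen (edge_map e)).
Proof. exact: hfunctorE. Qed.
End HMap.

Lemma hmap_id (X : sSet) : hmap (sid X) = fid (h X).
Proof. by apply: hfunctor_ext => x y e; rewrite hmap_gen; apply: pack_gen. Qed.
Lemma hmap_comp (X Y Z : sSet) (f : smap X Y) (g : smap Y Z) :
  hmap (scomp f g) = fcomp (hmap f) (hmap g).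
Proof.
by apply: hfunctor_ext => x y e; rewrite fmap_fcomp !hmap_gen; apply: pack_gen.
Qed.

(** ** The adjunction h -| nerve *)

Program Definition om_edge (n : nat) (i j : 'I_n.+1) (ij : i <= j) : ordmap 1 n :=
  @OrdMap 1 n (fun k => if k == ord0 then i else j) _.
Next Obligation.
move=> n i j ij k l /=; case: (ifP (k == _)) => k0; case: ifP => [/eqP->|] //.
by rewrite leqn0 => k00; rewrite -val_eqE k00 in k0.
Qed.

Lemma ord2P (P : 'I_2 -> Prop) : P ord0 -> P ord_max -> forall i, P i.
Proof.
move=> P0 P1 [[|[|//]] i_lt2]; [suff -> : Ordinal i_lt2 = ord0 by []|
  suff -> : Ordinal i_lt2 = ord_max by []]; exact: val_inj.
Qed.

Section Unit.
Variables (X : sSet) (n : nat) (x : X n).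

Definition vertex (i : 'I_n.+1) : X 0 := act (om_const 0 i) x.

Program Definition edge_of (i j : 'I_n.+1) (ij : i <= j) : edge (vertex i) (vertex j) :=
  exist _ (act (om_edge ij) x) _.
Next Obligation.
move=> i j ij; split; rewrite /face -act_comp; congr act; apply: ordmap_ext => k;
  by rewrite [k]ord1.
Qed.
End Unit.

Program Definition hunit_simplex (X : sSet) (n : nat) (x : X n) : functor (ordcat n) (h X) :=
  @Functor (ordcat n) (h X) (vertex x) (fun i j ij => hclass (HGen (edge_of x ij))) _ _.
Next Obligation.
move=> X n x i; apply/hclassP/HDegen; rewrite /= /degen0 -act_comp; congr act.
by apply: ordmap_ext => k /=; case: ifP.
Qed.
Next Obligation.
move=> X n x i j k ij jk; rewrite hclassM; apply/hclassP/HSym.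
pose f (l : 'I_3) := if l == 0 :> nat then i else if l == 1 :> nat then j else k.
have f_mono (l l' : 'I_3) : l <= l' -> f l <= f l'.
  have ik := leq_trans ij jk.
  by case: l l' => [[|[|[|//]]] l3] [[|[|[|//]]] l3'].
apply: (@HTriangle _ (act (OrdMap f_mono) x)); rewrite /= /face -act_comp;
  by congr act; apply: ordmap_ext; apply: ord2P.
Qed.

Program Definition hunit (X : sSet) : smap X (nerve (h X)) :=
  @SMap X (nerve (h X)) (@hunit_simplex X) _.
Next Obligation.
move=> X m n f x; apply: functor_ext => i j ij; apply: pack_gen; rewrite /= -act_comp.
by congr act; apply: ordmap_ext => k /=; case: ifP.
Qed.

Lemma hunit_natural (X Y : sSet) (f : smap X Y) :
  scomp (hunit X) (nerve_map (hmap f)) = scomp f (hunit Y).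
Proof.
apply: smap_ext => n x; apply: functor_ext => i j ij; rewrite [LHS]/= -/(fmap _ _).
have /= -> := hmap_gen f (edge_of x ij).
by apply: pack_gen; rewrite /= sapp_act.
Qed.

Definition chom (C : category) (x y x' y' : C) (ex : x = x') (ey : y = y') (f : hom x y) :
  hom x' y' := eq_hom (esym ex) ;; f ;; eq_hom ey.
Lemma pack_chom (C : category) (x y x' y' : C) (ex : x = x') (ey : y = y') (f : hom x y) :
  pack (chom ex ey f) = pack f.
Proof. by subst; rewrite /chom /= comp1m compm1. Qed.

Section Lift.
Variables (X : sSet) (C : category) (g : smap X (nerve C)).

Definition lift_ob (x : X 0) : C := g 0 x ord0.

Lemma lift_face (x : X 0) (e : X 1) (i : 'I_2) : face i e = x -> g 1 e (lift i ord0) = lift_ob x.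
Proof. by move=> <-; rewrite /lift_ob /face sapp_act. Qed.

Program Definition lift_edge (x y : X 0) (e : edge x y) : hom (lift_ob x) (lift_ob y) :=
  chom _ _ (@fmap _ _ (g 1 (sval e)) ord0 ord_max isT).
Next Obligation.
move=> x y e; rewrite -(lift_face (proj1 (proj2_sig e))); congr (g 1 _ _); exact: val_inj.
Qed.
Next Obligation.
move=> x y e; rewrite -(lift_face (proj2 (proj2_sig e))); congr (g 1 _ _); exact: val_inj.
Qed.

Lemma pack_lift_edge (x y : X 0) (e : edge x y) :
  pack (lift_edge e) = pack (@fmap _ _ (g 1 (sval e)) ord0 ord_max isT).
Proof. exact: pack_chom. Qed.

Lemma pack_lift_act (n : nat) (s : X n) (f : ordmap 1 n) (p : (f ord0 : ordcat n) <= f ord_max)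
    (x y : X 0) (e : edge x y) : sval e = act f s ->
  pack (lift_edge e) = pack (@fmap _ _ (g n s) _ _ p).
Proof. by move=> es; rewrite pack_lift_edge es sapp_act /=; apply: pack_ordcat. Qed.

Program Definition lift_functor : functor (h X) C := @hfunctor X C lift_ob lift_edge _ _.
Next Obligation.
move=> x e ex; apply: pack_inj.
rewrite (@pack_lift_act _ x (om_const 1 ord0) (leqnn _)) // -(fmap1 (g 0 x)).
exact: pack_ordcat.
Qed.
Next Obligation.
move=> s x y z e1 e2 e3 es1 es2 es3; apply: pack_inj.
have p12 : (ord0 : 'I_3) <= ord1_2 by [].
have p23 : ord1_2 <= (ord_max : 'I_3) by [].
have -> : pack (lift_edge e3) = pack (@fmap _ _ (g 2 s) _ _ p12 ;; @fmap _ _ (g 2 s) _ _ p23).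
  rewrite -fmapM (@pack_lift_act _ s (coface ord1_2) _ _ _ _ es3) //.
  by apply: pack_ordcat; apply: val_inj.
apply: pack_compm.
  rewrite (@pack_lift_act _ s (coface ord_max) _ _ _ _ es1) //.
  by apply: pack_ordcat; apply: val_inj.
rewrite (@pack_lift_act _ s (coface ord0) _ _ _ _ es2) //.
by apply: pack_ordcat; apply: val_inj.
Qed.

Lemma hunit_lift : scomp (hunit X) (nerve_map lift_functor) = g.
Proof.
apply: smap_ext => n s; apply: functor_ext => i j ij.
have -> : fmap (scomp (hunit X) (nerve_map lift_functor) n s) ij = lift_edge (edge_of s ij).
  exact: hfunctorE.
rewrite (@pack_lift_act _ s (om_edge ij) ij) //; exact: pack_ordcat.
Qed.
End Lift.

Theorem h_left_adjoint (X : sSet) (C : category) (g : smap X (nerve C)) :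
  exists! G : functor (h X) C, scomp (hunit X) (nerve_map G) = g.
Proof.
exists (lift_functor g); split; first exact: hunit_lift.
suff H (G : functor (h X) C) (x y : X 0) (e : edge x y) :
    pack (@fmap _ _ G x y (hclass (HGen e)))
    = pack (@fmap _ _ (scomp (hunit X) (nerve_map G) 1 (sval e)) ord0 ord_max isT).
  by move=> G Gg; apply: hfunctor_ext => x y e; rewrite (H G) (H (lift_functor g)) Gg hunit_lift.
have pack_fmap (a b a' b' : h X) (u : hom a b) (v : hom a' b') :
    pack u = pack v -> pack (fmap G u) = pack (fmap G v).
  by move=> uv; move: (pack_src uv) (pack_tgt uv) => ea eb; subst; rewrite (pack_inj uv).
apply: pack_fmap; apply: pack_gen => /=; rewrite -[LHS]act_id; congr act.
by apply: ordmap_ext; apply: ord2P => //=; apply: val_inj.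
Qed.

(** ** [h] preserves binary products *)

Section Product.
Variables X Y : sSet.

(* The canonical comparison; [hprod_inv] below is its inverse.                *)
Definition hprod : functor (h (sprod X Y)) (prodcat (h X) (h Y)) :=
  fpair (hmap (sfst X Y)) (hmap (ssnd X Y)).

Program Definition edge_pair (x x' : X 0) (y y' : Y 0) (e : edge x x') (f : edge y y') :
  @edge (sprod X Y) (x, y) (x', y') := exist _ (sval e, sval f) _.
Next Obligation.
move=> x x' y y' [e [ex ex']] [f [fy fy']] /=; rewrite /face /= -!/(face _ _).
by rewrite ex ex' fy fy'.
Qed.

Fixpoint hterm_inl (y : Y 0) (x x' : X 0) (p : hterm x x') :
    @hterm (sprod X Y) (x, y) (x', y) :=
  match p with
  | HGen _ _ e => HGen (edge_pair e (edge_degen y))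
  | HId x => HId ((x, y) : sprod X Y 0)
  | HComp _ _ _ p q => HComp (hterm_inl y p) (hterm_inl y q)
  end.
Fixpoint hterm_inr (x : X 0) (y y' : Y 0) (p : hterm y y') :
    @hterm (sprod X Y) (x, y) (x, y') :=
  match p with
  | HGen _ _ e => HGen (edge_pair (edge_degen x) e)
  | HId y => HId ((x, y) : sprod X Y 0)
  | HComp _ _ _ p q => HComp (hterm_inr x p) (hterm_inr x q)
  end.
End Product.

Lemma face_degen0_2 (X : sSet) (i : 'I_3) (x : X 0) :
  face i (act (om_const 2 ord0) x) = degen0 x.
Proof. by rewrite /face /degen0 -act_comp; congr act; apply: om0_eq. Qed.

Lemma hrel_inl (X Y : sSet) (y : Y 0) (x x' : X 0) (p q : hterm x x') :
  hrel p q -> hrel (hterm_inl y p) (hterm_inl y q).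
Proof.
elim=> {x x' p q} /=.
- by move=> x e ex; apply: HDegen; rewrite /= ex.
- move=> s x0 x1 x2 e f g es fs gs.
  by apply: (@HTriangle (sprod X Y) (s, act (om_const 2 ord0) y));
    rewrite /= /face /= -!/(face _ _) ?face_degen0_2 ?es ?fs ?gs.
- by move=> *; apply: HIdl.
- by move=> *; apply: HIdr.
- by move=> *; apply: HAssoc.
- by move=> *; apply: HCongr.
- by move=> *; apply: HRefl.
- by move=> *; apply: HSym.
- by move=> x x' p q r _ pq _ qr; apply: HTrans pq qr.
Qed.
Lemma hrel_inr (X Y : sSet) (x : X 0) (y y' : Y 0) (p q : hterm y y') :
  hrel p q -> hrel (hterm_inr x p) (hterm_inr x q).
Proof.
elim=> {y y' p q} /=.
- by move=> y e ey; apply: HDegen; rewrite /= ey.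
- move=> s y0 y1 y2 e f g es fs gs.
  by apply: (@HTriangle (sprod X Y) (act (om_const 2 ord0) x, s));
    rewrite /= /face /= -!/(face _ _) ?face_degen0_2 ?es ?fs ?gs.
- by move=> *; apply: HIdl.
- by move=> *; apply: HIdr.
- by move=> *; apply: HAssoc.
- by move=> *; apply: HCongr.
- by move=> *; apply: HRefl.
- by move=> *; apply: HSym.
- by move=> y y' p q r _ pq _ qr; apply: HTrans pq qr.
Qed.

(* The two degeneracies [2] -> [1]: [om_gt i] sends j to 0 iff j <= i.        *)
Program Definition om_gt (i : nat) : ordmap 2 1 :=
  @OrdMap 2 1 (fun j => if i < j then ord_max else ord0) _.
Next Obligation.
move=> i j k jk /=; case: ifP => // ij; case: ifP => //.
by rewrite (leq_trans ij jk).
Qed.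

Lemma face_gt (X : sSet) (e : X 1) :
  [/\ face ord_max (act (om_gt 0) e) = e,
      face ord0 (act (om_gt 0) e) = degen0 (face ord0 e) &
      face ord1_2 (act (om_gt 0) e) = e] /\
  [/\ face ord_max (act (om_gt 1) e) = degen0 (face ord_max e),
      face ord0 (act (om_gt 1) e) = e &
      face ord1_2 (act (om_gt 1) e) = e].
Proof.
rewrite /face /degen0 -!act_comp.
have act_ext n (f g : ordmap n 1) : f =1 g -> act f e = act g e by move/ordmap_ext->.
have act1 (f : ordmap 1 1) : f =1 id -> act f e = e.
  by move=> f1; rewrite -[RHS]act_id; apply: act_ext.
by do ![split]; (apply: act_ext || apply: act1); apply: ord2P; apply: val_inj.
Qed.

Section ProductInverse.
Variables X Y : sSet.

Lemma hrel_pairl (x x' : X 0) (y y' : Y 0) (e : edge x x') (f : edge y y') :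
  hrel (HComp (hterm_inl y (HGen e)) (hterm_inr x' (HGen f))) (HGen (edge_pair e f)).
Proof.
have [ex ex'] := proj2_sig e; have [fy fy'] := proj2_sig f.
have [[e2 e0 e1] _] := face_gt (sval e); have [_ [f2 f0 f1]] := face_gt (sval f).
by apply: (@HTriangle (sprod X Y) (act (om_gt 0) (sval e), act (om_gt 1) (sval f)));
  rewrite /= /face /= -!/(face _ _) ?e0 ?e1 ?e2 ?f0 ?f1 ?f2 ?ex' ?fy.
Qed.

Lemma hrel_pairr (x x' : X 0) (y y' : Y 0) (e : edge x x') (f : edge y y') :
  hrel (HComp (hterm_inr x (HGen f)) (hterm_inl y' (HGen e))) (HGen (edge_pair e f)).
Proof.
have [ex ex'] := proj2_sig e; have [fy fy'] := proj2_sig f.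
have [_ [e2 e0 e1]] := face_gt (sval e); have [[f2 f0 f1] _] := face_gt (sval f).
by apply: (@HTriangle (sprod X Y) (act (om_gt 1) (sval e), act (om_gt 0) (sval f)));
  rewrite /= /face /= -!/(face _ _) ?e0 ?e1 ?e2 ?f0 ?f1 ?f2 ?ex ?fy'.
Qed.

Lemma hrel_interchange (x x' : X 0) (y y' : Y 0) (p : hterm x x') (q : hterm y y') :
  hrel (HComp (hterm_inr x q) (hterm_inl y' p)) (HComp (hterm_inl y p) (hterm_inr x' q)).
Proof.
elim: p y y' q => {x x'} [x x' e|x|x1 x2 x3 p IHp p' IHp'] y y' q /=.
- elim: q => {y y'} [y y' f|y|y1 y2 y3 q IHq q' IHq'] /=.
  + exact: HTrans (hrel_pairr _ _) (HSym (hrel_pairl _ _)).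
  + exact: HTrans (HIdl _) (HSym (HIdr _)).
  + apply: HTrans (HSym (HAssoc _ _ _)) _.
    apply: HTrans (HCongr (HRefl _) IHq') _.
    apply: HTrans (HAssoc _ _ _) _.
    apply: HTrans (HCongr IHq (HRefl _)) _.
    exact: HSym (HAssoc _ _ _).
- exact: HTrans (HIdr _) (HSym (HIdl _)).
- apply: HTrans (HAssoc _ _ _) _.
  apply: HTrans (HCongr (IHp _ _ _) (HRefl _)) _.
  apply: HTrans (HSym (HAssoc _ _ _)) _.
  apply: HTrans (HCongr (HRefl _) (IHp' _ _ _)) _.
  exact: HAssoc.
Qed.

Program Definition hprod_inv : functor (prodcat (h X) (h Y)) (h (sprod X Y)) :=
  @Functor (prodcat (h X) (h Y)) (h (sprod X Y)) (fun a => (a.1, a.2))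
    (fun a b f => hclass (HComp (hterm_inl a.2 (hrepr f.1)) (hterm_inr b.1 (hrepr f.2)))) _ _.
Next Obligation.
move=> [x y]; apply/hclassP => /=; apply: HTrans (HIdl _).
by apply: HCongr; [apply: (hrel_inl y (hrepr_class _))|apply: (hrel_inr x (hrepr_class _))].
Qed.
Next Obligation.
move=> [x1 y1] [x2 y2] [x3 y3] [f1 f2] [g1 g2]; rewrite hclassM; apply/hclassP => /=.
apply: HTrans (HCongr (hrel_inl y1 (hrepr_class _)) (hrel_inr x3 (hrepr_class _))) _ => /=.
apply: HTrans (HSym (HAssoc _ _ _)) _.
apply: HTrans _ (HAssoc _ _ _); apply: HCongr (HRefl _) _.
apply: HTrans (HAssoc _ _ _) _; apply: HTrans _ (HSym (HAssoc _ _ _)).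
by apply: HCongr (HRefl _); apply: HSym; apply: hrel_interchange.
Qed.

Lemma hprod_invE (x x' : X 0) (y y' : Y 0) (p : hterm x x') (q : hterm y y') :
  @fmap _ _ hprod_inv (x, y) (x', y') (hclass p, hclass q)
  = hclass (HComp (hterm_inl y p) (hterm_inr x' q)).
Proof.
apply/hclassP => /=.
by apply: HCongr; [apply: hrel_inl|apply: hrel_inr]; apply: hrepr_class.
Qed.

Lemma hprodK : fcomp (hprod X Y) hprod_inv = fid _.
Proof.
apply: hfunctor_ext => [[x y]] [x' y'] e.
have -> : @fmap _ _ (fcomp (hprod X Y) hprod_inv) (x, y) (x', y') (hclass (HGen e))
  = @fmap _ _ hprod_inv (x, y) (x', y')
      (hclass (HGen (edge_map (sfst X Y) e)), hclass (HGen (edge_map (ssnd X Y) e))).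
  by rewrite -!hmap_gen.
rewrite hprod_invE (proj2 (hclassP _ _) (hrel_pairl _ _)); apply: pack_gen.
by rewrite /= -surjective_pairing.
Qed.

Lemma hprod_inl (y : Y 0) (x x' : X 0) (p : hterm x x') :
  @fmap _ _ (hprod X Y) (x, y) (x', y) (hclass (hterm_inl y p)) = (hclass p, idm (y : h Y)).
Proof.
elim: p => {x x'} [x x' e|x|x1 x2 x3 p IHp p' IHp'].
- have -> : @fmap _ _ (hprod X Y) (x, y) (x', y) (hclass (hterm_inl y (HGen e)))
    = (hclass (HGen (edge_map (sfst X Y) (edge_pair e (edge_degen y)))),
       hclass (HGen (edge_map (ssnd X Y) (edge_pair e (edge_degen y))))) by rewrite -!hmap_gen.
  by congr (_, _); [apply: pack_inj; apply: pack_gen|apply/hclassP/HDegen].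
- exact: (fmap1 (hprod X Y) (x, y)).
- by rewrite [hterm_inl _ _]/= -!hclassM fmapM IHp IHp'; congr (_, _); apply: comp1m.
Qed.

Lemma hprod_inr (x : X 0) (y y' : Y 0) (p : hterm y y') :
  @fmap _ _ (hprod X Y) (x, y) (x, y') (hclass (hterm_inr x p)) = (idm (x : h X), hclass p).
Proof.
elim: p => {y y'} [y y' e|y|y1 y2 y3 p IHp p' IHp'].
- have -> : @fmap _ _ (hprod X Y) (x, y) (x, y') (hclass (hterm_inr x (HGen e)))
    = (hclass (HGen (edge_map (sfst X Y) (edge_pair (edge_degen x) e))),
       hclass (HGen (edge_map (ssnd X Y) (edge_pair (edge_degen x) e)))) by rewrite -!hmap_gen.
  by congr (_, _); [apply/hclassP/HDegen|apply: pack_inj; apply: pack_gen].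
- exact: (fmap1 (hprod X Y) (x, y)).
- by rewrite [hterm_inr _ _]/= -!hclassM fmapM IHp IHp'; congr (_, _); apply: comp1m.
Qed.

Lemma hprod_invK : fcomp hprod_inv (hprod X Y) = fid _.
Proof.
apply: functor_ext => [[x y] [x' y'] [c d]].
suff e : @fmap _ _ (fcomp hprod_inv (hprod X Y)) (x, y) (x', y') (c, d) = (c, d).
  exact: (congr1 (@pack (prodcat (h X) (h Y)) (x, y) (x', y')) e).
elim/hhom_ind: c => p; elim/hhom_ind: d => q.
rewrite fmap_fcomp hprod_invE -hclassM fmapM hprod_inl hprod_inr.
exact: (f_equal2 pair (compm1 (hclass p : @hom (h X) _ _)) (comp1m (hclass q : @hom (h Y) _ _))).
Qed.
End ProductInverse.

Lemma hprod_natural (X Y X' Y' : sSet) (f : smap X X') (g : smap Y Y') :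
  fcomp (hmap (sprodmap f g)) (hprod X' Y') = fcomp (hprod X Y) (fprod (hmap f) (hmap g)).
Proof.
rewrite fcomp_fpair fpair_fprod -!hmap_comp.
by congr (fpair (hmap _) (hmap _)); apply: smap_ext.
Qed.

Lemma hprodKA (X Y : sSet) (C : category) (F : functor (h (sprod X Y)) C) :
  fcomp (hprod X Y) (fcomp (hprod_inv X Y) F) = F.
Proof. by rewrite fcompA hprodK fcomp1f. Qed.

(** * The 2-category of quasi-categories *)

(* The image under h of the enriched composition, transported along the       *)
(* isomorphism h (C^B x B^A) = h (C^B) x h (B^A).                             *)
Definition hcomp1 (A B C : sSet) :
    functor (prodcat (h (sexp C B)) (h (sexp B A))) (h (sexp C A)) :=
  fcomp (hprod_inv (sexp C B) (sexp B A)) (hmap (sexp_comp A B C)).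

Lemma hcomp1A (A B C D : sSet) :
  fcomp (fassoc (h (sexp D C)) (h (sexp C B)) (h (sexp B A)))
        (fcomp (fprod (fid _) (hcomp1 A B C)) (hcomp1 A C D))
  = fcomp (fprod (hcomp1 B C D) (fid _)) (hcomp1 A B D).
Proof.
set P := sexp D C; set Q := sexp C B; set R := sexp B A.
pose E := fcomp (hprod (sprod P Q) R) (fprod (hprod P Q) (fid (h R))).
pose E' := fcomp (fprod (hprod_inv P Q) (fid (h R))) (hprod_inv (sprod P Q) R).
have E'E : fcomp E' E = fid _.
  rewrite -fcompA (fcompA (hprod_inv _ _)) hprod_invK fcomp1f fprod_fprod hprod_invK fcompf1.
  exact: fprod1.
suff EFG : forall F G : functor _ (h (sexp D A)), fcomp E F = fcomp E G -> F = G.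
  apply: EFG; rewrite fcompA.
  have -> : fcomp E (fassoc (h P) (h Q) (h R))
      = fcomp (hmap (sassoc P Q R)) (fcomp (hprod P (sprod Q R)) (fprod (fid _) (hprod Q R))).
    rewrite /E /hprod !(fcomp_fpair, fpair_fprod, fcompf1, fpair_fassoc) -!hmap_comp.
    by congr (fpair (hmap _) (fpair (hmap _) (hmap _))); apply: smap_ext.
  rewrite -!fcompA (fcompA (fprod (fid _) _)) fprod_fprod fcomp1f hprodKA.
  rewrite (fcompA (fprod (hprod _ _) _)) fprod_fprod fcomp1f hprodKA.
  rewrite -!hmap_id (fcompA (hprod _ _)) -hprod_natural -fcompA hprodKA -!hmap_comp.
  rewrite (fcompA (hprod _ _)) -hprod_natural -fcompA hprodKA -!hmap_comp.
  by congr hmap; apply: smap_ext => n x; apply: smap_ext.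
by move=> F G FG; rewrite -(fcomp1f F) -E'E -[LHS]fcompA FG fcompA E'E fcomp1f.
Qed.

Definition sid1 (A : sSet) : sexp A A 0 := sname (sid A).

Lemma hcomp1_1f (A B : sSet) :
  fcomp (fpair (fconst (h (sexp B A)) (sid1 B : h (sexp B B))) (fid _)) (hcomp1 A B B) = fid _.
Proof.
apply: hfunctor_ext => f f' e.
rewrite !fmap_fcomp (hprod_invE (HId (sid1 B)) (HGen e)) (proj2 (hclassP _ _) (HIdl _)) hmap_gen.
by apply: pack_gen; apply: smap_ext => n [a s].
Qed.
Lemma hcomp1_f1 (A B : sSet) :
  fcomp (fpair (fid _) (fconst (h (sexp B A)) (sid1 A : h (sexp A A)))) (hcomp1 A A B) = fid _.
Proof.
apply: hfunctor_ext => f f' e.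
rewrite !fmap_fcomp (hprod_invE (HGen e) (HId (sid1 A))) (proj2 (hclassP _ _) (HIdr _)) hmap_gen.
by apply: pack_gen; apply: smap_ext => n [a s].
Qed.

Record qcat := QCat { qcarrier :> sSet; qcatP : is_quasicategory qcarrier }.

Lemma is_quasicategory_pt : is_quasicategory (Delta 0).
Proof. by move=> n k _ f; exists (bang _); rewrite (bang_unique f); apply: bang_unique. Qed.
Definition qpt : qcat := QCat is_quasicategory_pt.

Definition qCat2 : strict2cat :=
  @Strict2cat qcat (fun A B => h (sexp B A)) (fun A => sid1 A) (fun A B C => hcomp1 A B C)
    (fun A B C D => hcomp1A A B C D) (fun A B => hcomp1_1f A B) (fun A B => hcomp1_f1 A B).

Definition qfunctor (A B : qcat) (f : smap A B) : cell1 (A : qCat2) (B : qCat2) := sname f.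

(* Main.v *)
(* A natural transformation from the identity to the constant map at t is built   *)
(* cell by cell on A x Delta^1 when t is terminal in Joyal's sense: the cells to  *)
(* fill are those whose last vertex goes to t.  Conversely, a unit is only a path *)
(* of edges of A^A; since A/t -> A is a right fibration, the constant cone at t   *)
(* lifts backwards along this path to a section c of A/t -> A.  By the triangle   *)
(* identity the edge c t is the identity of t in h A, so some 2-simplex           *)
(* w = (t, t', t'') has faces c t and the degenerate edge (t, t'').  Given a      *)
(* sphere b = (b_0, .., b_n, t), inner horns extend each of its faces (x, t)      *)
(* through t to simplices (x, t, t', t'') ending with w, (x, t, t') = c (x, t) and *)
(* (x, t, t'') degenerate; the faces (x, t', t''), together with the simplex      *)
(* c (b_0, .., b_n), form an inner horn, and the missing face of its filler       *)
(* fills b.                                                                       *)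

From mathcomp Require Import all_boot.
From mathcomp Require Import boolp classical_sets zify.
Require Import Defs.

Set Implicit Arguments.
Unset Strict Implicit.
Unset Printing Implicit Defensive.

Local Obligation Tactic := idtac.
Local Open Scope cat_scope.

(** * Faces *)

(** Let [t] be terminal in Joyal's sense. A homotopy from the identity of [A] to the constant map at
    [t], stationary at [t], is built cell by cell on A x Delta^1: a cell with no prescribed value
    has its last vertex over 1, hence sent to [t], and terminality fills its sphere
    ([joyal_transformation]). Its class is the unit; h of (Delta^0)^A has only identity morphisms,
    and stationarity at [t] gives the second triangle identity.

    Conversely, a unit is the class of a word of edges of A^A. Right horns fill in the slice A/t
    ([slice_right_fill]), so a transformation lifts to A/t once its target is lifted
    ([lift_transformation]), and so does a word ([lift_path]). From the constant cone at [t] this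
    yields a section [c] of A/t -> A. The relation [triangle_along] between the cones at both ends
    of a word depends only on its class ([triangle_along_hrel]), so the triangle identity makes
    [c t] homotopic to a degenerate edge. [joyal_terminal_of_retraction] turns [c] and this homotopy
    into fillers of spheres. *)

Lemma val_inord n i : i <= n -> (inord i : 'I_n.+1) = i :> nat.
Proof. exact: inordK. Qed.

(** A natural number as index turns the face identities into goals for [lia]; beyond n+1 the map
    equals the last coface. *)
Program Definition omd (n i : nat) : ordmap n n.+1 :=
  @OrdMap n n.+1 (fun j => @Ordinal n.+2 (bump i j) _) _.
Next Obligation. by move=> n i [j lj]; rewrite /= /bump; lia. Qed.
Next Obligation. by move=> n i j k jk /=; rewrite leq_bump2. Qed.

Lemma ordmap_ext_nat m n (f g : ordmap m n) :
  (forall j : 'I_m.+1, f j = g j :> nat) -> f = g.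
Proof. by move=> fg; apply: ordmap_ext => j; apply: val_inj; apply: fg. Qed.

Lemma coface_omd n (i : 'I_n.+2) : coface i = omd n i.
Proof. by apply: ordmap_ext => j; apply: val_inj. Qed.

Definition dface (X : sSet) n (i : nat) (x : X n.+1) : X n := act (omd n i) x.

Lemma face_dface (X : sSet) n (i : 'I_n.+2) (x : X n.+1) : face i x = dface i x.
Proof. by rewrite /face coface_omd. Qed.

Lemma act_ext (X : sSet) m n (f g : ordmap m n) (x : X n) :
  (forall j : 'I_m.+1, f j = g j :> nat) -> act f x = act g x.
Proof. by move/ordmap_ext_nat->. Qed.

Lemma dface_dface (X : sSet) n (i j : nat) (x : X n.+2) :
  i < j -> dface i (dface j x) = dface j.-1 (dface i x).
Proof.
by move=> ij; rewrite /dface -!act_comp; apply: act_ext => k /=; rewrite /bump; lia.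
Qed.

Lemma sapp_dface (X Y : sSet) (f : smap X Y) n i (x : X n.+1) :
  f n (dface i x) = dface i (f n.+1 x).
Proof. exact: sapp_act. Qed.

Lemma om_factor m n (s : ordmap m n.+1) (i : nat) :
  i <= n.+1 -> (forall j, s j != i :> nat) -> exists u : ordmap m n, s = om_comp (omd n i) u.
Proof.
move=> lei si.
have b j : unbump i (s j) < n.+1.
  by move: (si j) (ltn_ord (s j)); rewrite /unbump; lia.
have mono (j k : 'I_m.+1) : j <= k -> Ordinal (b j) <= Ordinal (b k).
  by move=> /(ordfun_mono s) /=; rewrite /unbump; lia.
exists (OrdMap mono); apply: ordmap_ext => j; apply: val_inj; rewrite /= unbumpK //.
by rewrite inE.
Qed.

Lemma om_boundary_factor m n (s : ordmap m n.+1) :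
  in_boundary (s : Delta n.+1 m) ->
  exists i (u : ordmap m n), i <= n.+1 /\ s = om_comp (omd n i) u.
Proof.
case=> i si; have [||u su] := @om_factor m n s i.
- by rewrite -ltnS.
- by move=> j; apply/eqP => e; apply: (si j); apply: val_inj.
by exists (i : nat), u; split => //; rewrite -ltnS.
Qed.

Lemma omd_boundary n i : i <= n.+1 -> in_boundary (omd n i : Delta n.+1 n).
Proof.
move=> lei; exists (inord i) => j /(congr1 val); rewrite /= inordK ?ltnS // => e.
by have := neq_bump i j; rewrite e eqxx.
Qed.

Lemma boundary0 m (s : ordmap m 0) : ~ in_boundary (s : Delta 0 m).
Proof. by case=> i /(_ ord0); rewrite !ord1. Qed.

(** Any choice of preimages under a monotone surjection is monotone, so the preimage of [s j0] can
    be prescribed. *)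
Lemma om_section m n (s : ordmap m n) (j0 : 'I_m.+1) :
  ~ in_boundary (s : Delta n m) ->
  exists2 d : ordmap n m, om_comp s d = om_id n & d (s j0) = j0.
Proof.
move=> s_surj.
have surj (i : 'I_n.+1) : exists j, s j = i.
  by apply: contrapT => /forallNP si; apply: s_surj; exists i.
have /choice [d0 sd0] := surj.
pose d i := if i == s j0 then j0 else d0 i.
have sd i : s (d i) = i by rewrite /d; case: eqP => [->|].
have d_mono (i k : 'I_n.+1) : i <= k -> d i <= d k.
  rewrite leq_eqVlt => /orP [/eqP/val_inj->//|]; apply: contraLR; rewrite -!ltnNge => dk.
  by rewrite ltnS -(sd i) -(sd k); apply: ordfun_mono; apply: ltnW.
exists (OrdMap d_mono) => /=; last by rewrite /d eqxx.
exact: ordmap_ext.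
Qed.

Lemma om_surj_id n (s : ordmap n n) : ~ in_boundary (s : Delta n n) -> s = om_id n.
Proof.
move=> s_surj; have [d sd _] := om_section ord0 s_surj.
have sdK : cancel d s by move=> i; have := congr1 (fun f : ordmap n n => f i) sd.
have dsK : cancel s d.
  have [d' d'd dd'] := injF_bij (can_inj sdK).
  by move=> i; rewrite -{1}(dd' i) sdK dd'.
have ge_id (f : ordmap n n) : injective f -> forall k (i : 'I_n.+1), i = k :> nat -> i <= f i.
  move=> f_inj; elim=> [|k IHk] i ik; first by rewrite ik.
  have kn : k < n.+1 by have := ltn_ord i; rewrite ik; apply: ltn_trans.
  have := IHk (Ordinal kn) erefl; have : f (Ordinal kn) <= f i by apply: ordfun_mono; rewrite /= ik.
  rewrite leq_eqVlt => /orP [/eqP/val_inj/f_inj/(congr1 val) /= |]; first by rewrite ik; lia.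
  by move=> lt le; rewrite ik; apply: leq_ltn_trans lt.
apply: ordmap_ext => i; apply: val_inj; apply/eqP; rewrite eqn_leq /=.
rewrite (ge_id s (can_inj dsK) _ _ erefl) andbT.
by rewrite -[leqRHS](congr1 val (dsK i)) (ge_id d (can_inj sdK) _ _ erefl).
Qed.

(** With [xpredT] such a family is a sphere in [X], with [predC1 k] a k-th horn. Vertices have no
    faces to match, whence the case 0. *)
Definition compat (P : pred nat) (X : sSet) n : (nat -> X n) -> Prop :=
  match n with
  | 0 => fun _ => True
  | m.+1 => fun y => forall i j, P i -> P j -> i < j -> j <= m.+2 ->
              dface i (y j) = dface j.-1 (y i)
  end.

(** A simplex lying in two distinct faces factors through their common face of codimension two,
    where compatibility applies. *)
Lemma compat_act (P : pred nat) (X : sSet) n (y : nat -> X n) m (u v : ordmap m n) i j :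
  compat P y -> P i -> P j -> i <= n.+1 -> j <= n.+1 ->
  om_comp (omd n i) u = om_comp (omd n j) v -> act u (y i) = act v (y j).
Proof.
move=> cy; wlog ij : i j u v / i <= j => [H Pi Pj lei lej uv|].
  by case: (leqP i j) => ij; [|symmetry]; apply: H => //; apply: ltnW.
move: ij; rewrite leq_eqVlt => /orP [/eqP<- _ _ _ _ uv|ij Pi Pj _ lej uv].
  congr act; apply: ordmap_ext => k; apply: val_inj.
  have /(congr1 val)/= := congr1 (fun f : ordmap m n.+1 => f k) uv.
  by rewrite /bump; lia.
have uvk k : bump i (u k) = bump j (v k).
  by have /(congr1 val)/= := congr1 (fun f : ordmap m n.+1 => f k) uv.
case: n => [|n] in y cy u v uv uvk lej *.
  by move: (uvk ord0); rewrite !ord1 /= /bump; lia.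
have [||u' uu'] := @om_factor m n u j.-1; first by lia.
  by move=> k; apply/eqP => uk; move: (uvk k); rewrite uk /bump; lia.
have [||v' vv'] := @om_factor m n v i; first by lia.
  by move=> k; apply/eqP => vk; move: (uvk k); rewrite vk /bump; lia.
rewrite uu' vv' !act_comp -!/(dface _ _) (cy i j) //; apply: act_ext => k.
by move: (uvk k); rewrite uu' vv' /= /bump; lia.
Qed.

Lemma glue_faces (P : pred nat) (X : sSet) n (y : nat -> X n) : compat P y ->
  exists F : forall m, ordmap m n.+1 -> X m,
    forall m i (u : ordmap m n), P i -> i <= n.+1 -> F m (om_comp (omd n i) u) = act u (y i).
Proof.
move=> cy.
have H m (s : ordmap m n.+1) : exists z : X m, forall i (u : ordmap m n),
    P i -> i <= n.+1 -> s = om_comp (omd n i) u -> z = act u (y i).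
  case: (pselect (exists i (u : ordmap m n), [/\ P i, i <= n.+1 & s = om_comp (omd n i) u])).
    by move=> [i [u [Pi lei ->]]]; exists (act u (y i)) => j v Pj lej; apply: compat_act cy _ _ _ _.
  (* Simplices outside the chosen faces get an arbitrary value. *)
  move=> no; exists (act (om_const m ord0) (y 0)) => i u Pi lei si; exfalso; apply: no.
  by exists i, u.
exists (fun m s => sval (cid (H m s))) => m i u Pi lei.
exact: (proj2_sig (cid (H m (om_comp (omd n i) u)))).
Qed.

Section Faces.
Variable A : sSet.

Lemma inner_fill : is_quasicategory A -> forall n k (y : nat -> A n.+1), 0 < k < n.+2 ->
  compat (predC1 k) y -> exists a : A n.+2, forall i, i <= n.+2 -> i != k -> dface i a = y i.
Proof.
move=> qA n k y k_in cy; have [F FE] := glue_faces cy.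
have kn : k < n.+3 by lia.
pose K : 'I_n.+3 := Ordinal kn.
have F_act m p (f : ordmap m p) (s : horn K p) : F m (om_comp (sval s) f) = act f (F p (sval s)).
  case: s => s /= [i ik si].
  have [||u ->] := @om_factor p n.+1 s i; first by rewrite -ltnS.
    by move=> j; apply/eqP => /val_inj; apply: si.
  have Pi : predC1 k (i : nat) by apply/eqP => e; apply: ik; apply: val_inj.
  have lei : i <= n.+2 by rewrite -ltnS.
  by rewrite (FE _ _ u) // -act_comp -(FE _ _ (om_comp u f)) //; congr F; apply: ordmap_ext.
have [g gF] := qA n.+2 K k_in (SMap F_act).
exists (g n.+2 (om_id _)) => i lei ik; rewrite /dface -sapp_act.
have hi : in_horn K (omd n.+1 i : Delta n.+2 n.+1).
  exists (inord i) => [/(congr1 val)|j /(congr1 val)]; rewrite /= inordK //; first exact/eqP.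
  by move=> e; have := neq_bump i j; rewrite e eqxx.
have := congr1 (fun h : smap (horn K) A => h n.+1 (exist _ _ hi)) gF => /= e.
transitivity (F n.+1 (omd n.+1 i)); first by rewrite -e; congr (g _ _); apply: ordmap_ext.
rewrite -[RHS]act_id -FE //; congr F; exact: ordmap_ext.
Qed.

(** The last vertex of a sphere is read off its face 0, which contains it in every dimension. *)
Lemma joyal_terminalP (t : A 0) : joyal_terminal t <->
  forall n (y : nat -> A n), compat xpredT y -> act (om_const 0 ord_max) (y 0) = t ->
    exists a : A n.+1, forall i, i <= n.+1 -> dface i a = y i.
Proof.
split=> [tT n y cy yt|H [//|n] n_gt0 f ft].
  have [F FE] := glue_faces cy.
  have F_act m p (f : ordmap m p) (s : boundary n.+1 p) :
      F m (om_comp (sval s) f) = act f (F p (sval s)).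
    case: s => s /= /om_boundary_factor [i [u [lei ->]]].
    by rewrite (FE _ _ u) // -act_comp -(FE _ _ (om_comp u f)) //; congr F; apply: ordmap_ext.
  have [|g gF] := tT n.+1 isT (SMap F_act).
    by rewrite /= -yt -FE //; congr F; apply: ordmap_ext => j; apply: val_inj.
  exists (g n.+1 (om_id _)) => i lei; rewrite /dface -sapp_act.
  have := congr1 (fun h : smap (boundary n.+1) A => h n (exist _ _ (omd_boundary lei))) gF => /= e.
  transitivity (F n (omd n i)); first by rewrite -e; congr (g _ _); apply: ordmap_ext.
  rewrite -[RHS]act_id -FE //; congr F; exact: ordmap_ext.
have bdP i : in_boundary (omd n (inord i : 'I_n.+2) : Delta n.+1 n).
  by apply: omd_boundary; rewrite -ltnS.
pose y i := f n (exist _ _ (bdP i)).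
have [||a ay] := H n y.
- rewrite /y {y}; case: n {n_gt0 ft H} f bdP => // n f bdP i j _ _ ij lej.
  rewrite /dface -!sapp_act; congr (f _ _); apply: eq_exist => /=; apply: ordmap_ext => k.
  by apply: val_inj; rewrite /= !val_inord /bump; lia.
- rewrite -ft /y -sapp_act; congr (f _ _); apply: eq_exist => /=; apply: ordmap_ext => k.
  by apply: val_inj; rewrite /= val_inord.
exists (yoneda a); apply: smap_ext => m [s bs] /=.
have [i [u [lei su]]] := om_boundary_factor bs.
rewrite {1}su act_comp -/(dface i a) ay // /y -sapp_act; congr (f _ _); apply: eq_exist.
by rewrite /= val_inord.
Qed.
End Faces.

(** * Extending partial maps cell by cell *)

Section PartialMaps.
Variables X Z : sSet.
Implicit Type R : forall n, X n -> Z n -> Prop.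

(** Graphs of simplicial maps to [Z] defined on a simplicial subset of [X], namely [pdom R]. *)
Definition partial_map R : Prop :=
  (forall n x z z', R n x z -> R n x z' -> z = z') /\
  (forall m n (f : ordmap m n) x z, R n x z -> R m (act f x) (act f z)).

Definition pdom R n (x : X n) : Prop := exists z, R n x z.

Lemma partial_map_compat R (P : pred nat) n (x : X n.+1) (y : nat -> Z n) :
  partial_map R -> (forall i, P i -> i <= n.+1 -> R n (dface i x) (y i)) -> compat P y.
Proof.
move=> [R_fun R_act]; case: n x y => //= n x y xy i j Pi Pj ij lej.
apply: (R_fun _ (dface i (dface j x))); first by apply: R_act; apply: xy.
by rewrite dface_dface //; apply: R_act; apply: xy => //; lia.
Qed.

Lemma pdom_faces R n (x : X n.+1) (P : pred nat) :
  (exists z : Z n, True) -> (forall i, P i -> i <= n.+1 -> pdom R (dface i x)) ->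
  exists y : nat -> Z n, forall i, P i -> i <= n.+1 -> R n (dface i x) (y i).
Proof.
move=> [z0 _] H.
suff /choice [y yR] : forall i, exists z, P i -> i <= n.+1 -> R n (dface i x) z by exists y.
move=> i.
have [/andP [Pi lei]|no] := boolP (P i && (i <= n.+1)).
  by have [z] := H i Pi lei; exists z.
by exists z0 => Pi lei; rewrite Pi lei in no.
Qed.

Lemma partial_map_total R : partial_map R -> (forall n x, @pdom R n x) ->
  exists f : smap X Z, forall n (x : X n), R n x (f n x).
Proof.
move=> [R_fun R_act] R_tot; pose f n x := sval (cid (@R_tot n x)).
have fR n x : R n x (f n x) := proj2_sig (cid (@R_tot n x)).
have f_act m n (g : ordmap m n) (x : X n) : f m (act g x) = act g (f n x).
  by apply: R_fun (fR _ _) _; apply: R_act.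
by exists (SMap f_act).
Qed.

Section Attach.
Variables (R : forall n, X n -> Z n -> Prop) (n : nat) (x : X n) (z : Z n).

Definition attach m (y : X m) (w : Z m) : Prop :=
  R y w \/ exists s : ordmap m n, y = act s x /\ w = act s z.

(* A surjective [s] with [act s x] in the domain has a section, which brings [x] back into *)
(* the domain; and if [act s x = act s' x] with [s] surjective, then every section of [s]   *)
(* is one of [s'].                                                                          *)
Lemma attach_partial_map : partial_map R -> ~ pdom R x ->
  (forall m (s : ordmap m n), in_boundary (s : Delta n m) -> R (act s x) (act s z)) ->
  partial_map attach.
Proof.
move=> [R_fun R_act] xR bR.
have dec m (s : ordmap m n) w : R (act s x) w -> w = act s z.
  move=> sw; case: (pselect (in_boundary (s : Delta n m))) => [/bR|s_surj].
    exact: R_fun sw.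
  have [d sd _] := om_section ord0 s_surj; case: xR; exists (act d w).
  by rewrite -[x]act_id -sd act_comp; apply: R_act.
split=> [m y w w'|m p f y w].
  case=> [yw|[s [-> ->]]] [yw'|[s' [ss' ->]]].
  - exact: R_fun yw yw'.
  - by apply: dec; rewrite -ss'.
  - by symmetry; apply: dec.
  case: (pselect (in_boundary (s : Delta n m))) => [/bR|s_surj].
    by rewrite ss' => /dec.
  suff -> : s = s' by [].
  apply: ordmap_ext => j; have [d sd sdj] := om_section j s_surj.
  have s'd : om_comp s' d = om_id n.
    apply: om_surj_id => /bR; rewrite act_comp -ss' -act_comp sd act_id => xz.
    by apply: xR; exists (act (om_comp s' d) z).
  by have := congr1 (fun f : ordmap n n => f (s j)) s'd; rewrite /= sdj.
case=> [yw|[s [-> ->]]]; first by left; apply: R_act.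
by right; exists (om_comp s f); rewrite !act_comp.
Qed.

End Attach.

Lemma attach_faces R n (x : X n.+1) (z : Z n.+1) : partial_map R -> ~ pdom R x ->
  (forall i, i <= n.+1 -> R n (dface i x) (dface i z)) -> partial_map (attach R x z).
Proof.
move=> pR xR fR; apply: attach_partial_map => // m s /om_boundary_factor [i [u [lei ->]]].
by rewrite !act_comp; apply: pR.2; apply: fR.
Qed.

(* With [E] seen as a simplicial subset of the product, this says that a trivial fibration     *)
(* [E -> X] has a section.                                                                      *)
Lemma section_of_trivial_fibration (E : forall n, X n -> Z n -> Prop) :
  (forall m n (f : ordmap m n) x z, E n x z -> E m (act f x) (act f z)) ->
  (forall x, exists z, E 0 x z) ->
  (forall n (x : X n.+1) (y : nat -> Z n), compat xpredT y ->
     (forall i, i <= n.+1 -> E n (dface i x) (y i)) ->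
     exists z, E n.+1 x z /\ forall i, i <= n.+1 -> dface i z = y i) ->
  exists f : smap X Z, forall n (x : X n), E n x (f n x).
Proof.
move=> E_act E0 ES; pose T := {n : nat & (X n * Z n)%type}.
pose rel_of (S : set T) n (x : X n) (z : Z n) := S (existT _ n (x, z)).
pose good (S : set T) := partial_map (rel_of S) /\ forall n x z, rel_of S n x z -> E n x z.
have [|S [[pS SE] S_max]] := @Zorn_bigcup T good.
  move=> F Fgood Fchain; split; last by move=> n x z [S FS /(Fgood _ FS).2].
  split=> [n x z z' [S FS Sz] [S' FS' Sz']|m n f x z [S FS Sz]]; last first.
    by exists S => //; apply: (Fgood _ FS).1.2.
  case: (Fchain _ _ FS FS') => SS'.
    exact: (Fgood _ FS').1.1 (SS' _ Sz) Sz'.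
  exact: (Fgood _ FS).1.1 Sz (SS' _ Sz').
(* By maximality no cell can be attached to [S]. A cell outside the domain with all its faces inside
   could be, so induction on the dimension makes the domain everything. *)
have S_attach n (x : X n) (z : Z n) : ~ pdom (rel_of S) x -> E n x z ->
    ~ partial_map (attach (rel_of S) x z).
  move=> xS xz pR; pose S' : set T := fun a => attach (rel_of S) x z (projT2 a).1 (projT2 a).2.
  apply: (S_max S') => [|]; last first.
    split; first by [].
    by move=> m y w [/SE //|/= [s [-> ->]]]; apply: E_act.
  split; first by move=> [m [y w]] Sy; left.
  move=> S'S; apply: xS; exists z; apply: S'S; right; exists (om_id n) => /=.
  by rewrite !act_id.
have S_tot n (x : X n) : pdom (rel_of S) x.
  elim: n x => [|n IHn] x; apply: contrapT => xS.
    have [z xz] := E0 x; apply: (S_attach _ _ _ xS xz).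
    by apply: attach_partial_map => // m s /boundary0.
  have [|y xy] := @pdom_faces (rel_of S) _ x xpredT _ (fun i _ _ => IHn (dface i x)).
    by have [z] := IHn (dface 0 x); exists z.
  have [||z [xz zy]] := ES n x y.
  - by apply: partial_map_compat pS _; apply: xy.
  - by move=> i lei; apply: SE; apply: xy.
  by apply: (S_attach _ _ _ xS xz); apply: attach_faces => // i lei; rewrite zy //; apply: xy.
have [f fS] := partial_map_total pS S_tot.
by exists f => n x; apply: SE.
Qed.
End PartialMaps.

(** * From terminal vertices to adjunctions *)

(** Up to [pack], the coherence 2-cells [eq_hom] can be erased from the triangle identities. *)
Lemma pack_eq_hom (C : category) (x y : C) (e : x = y) : pack (eq_hom e) = pack (idm x).
Proof. by subst. Qed.

Lemma pack_compm_idl (C : category) (x y z c : C) (f : hom x y) (g : hom y z) :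
  pack f = pack (idm c) -> pack (f ;; g) = pack g.
Proof.
move=> e; move: (pack_src e) (pack_tgt e) => ex ey; subst.
by rewrite (pack_inj e) comp1m.
Qed.

Lemma pack_compm_idr (C : category) (x y z c : C) (f : hom x y) (g : hom y z) :
  pack g = pack (idm c) -> pack (f ;; g) = pack f.
Proof.
move=> e; move: (pack_src e) (pack_tgt e) => ex ey; subst.
by rewrite (pack_inj e) compm1.
Qed.

Lemma pack_fmap (C D : category) (F : functor C D) (x y x' y' : C) (f : hom x y) (g : hom x' y') :
  pack f = pack g -> pack (fmap F f) = pack (fmap F g).
Proof.
move=> e; move: (pack_src e) (pack_tgt e) => ex ey; subst.
by rewrite (pack_inj e).
Qed.

Lemma pack_whiskl_id (K : strict2cat) (A B C : K) (g : cell1 B C) (f f' c : cell1 A B)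
    (a : hom f f') : pack a = pack (idm c) -> pack (whiskl g a) = pack (idm (comp1_ob g c)).
Proof.
move=> e; move: (pack_src e) (pack_tgt e) => ex ey; subst.
by rewrite (pack_inj e) /whiskl /hcomp2 -(fmap1 (comp1 A B C)).
Qed.

Lemma pack_edge_degen (X : sSet) (x y v : X 0) (e : edge x y) : sval e = degen0 v ->
  @pack (h X) x y (hclass (HGen e)) = @pack (h X) v v (idm (v : h X)).
Proof.
move=> ev; have -> : idm (v : h X) = hclass (HGen (edge_degen v)).
  by symmetry; apply/hclassP/HDegen.
exact: pack_gen.
Qed.

Section Thin.
Variable X : sSet.
Hypothesis X_thin : forall n (x y : X n), x = y.

Lemma pack_thin (x y v : h X) (f : hom x y) : pack f = pack (idm v).
Proof.
elim/hhom_ind: f; elim=> {x y}.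
- by move=> x y e; apply: pack_edge_degen; apply: X_thin.
- by move=> x; apply: (@pack_idm (h X)); apply: X_thin.
- by move=> x y z p IHp q IHq; rewrite -hclassM (pack_compm_idl _ IHp).
Qed.

Lemma hom_thin (x y : h X) (f g : hom x y) : f = g.
Proof. by apply: pack_inj; rewrite !(pack_thin x). Qed.
End Thin.

Lemma sexp_pt_thin (A : sSet) n (x y : sexp (Delta 0) A n) : x = y.
Proof. by rewrite (bang_unique x) (bang_unique y). Qed.

Lemma act00 (X : sSet) (f : ordmap 0 0) (x : X 0) : act f x = x.
Proof. by rewrite (om0_eq f (om_id 0)) act_id. Qed.

Section Precomposition.
Variables (A B C : sSet) (u : sexp B A 0).

Program Definition sprecomp : smap (sexp C B) (sexp C A) :=
  @SMap (sexp C B) (sexp C A)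
    (fun n x => @SMap (sprod A (Delta n)) C
       (fun m y => x m (u m (y.1, om_const m ord0), y.2)) _) _.
Next Obligation.
move=> n x m p f [a s]; rewrite -(sapp_act x) /= -(sapp_act u) /=.
by congr (x _ (u _ (_, _), _)); apply: om0_eq.
Qed.
Next Obligation. by move=> m n f x; apply: smap_ext. Qed.

(** Composing with the identity 2-cell of [u] is already simplicial precomposition, so whiskering by
    [u] is the image under [h] of a simplicial map. *)
Lemma hcomp1_precomp :
  fcomp (fpair (fid (h (sexp C B))) (fconst _ (u : h (sexp B A)))) (hcomp1 A B C)
  = hmap sprecomp.
Proof.
apply: hfunctor_ext => x y e.
rewrite !fmap_fcomp (hprod_invE (HGen e) (HId u)) (proj2 (hclassP _ _) (HIdr _)) !hmap_gen.
apply: pack_gen; apply: smap_ext => n [a s] /=.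
by congr (sval e _ (u _ (_, _), _)); apply: om0_eq.
Qed.

End Precomposition.

Lemma pack_whiskr_qCat2 (A B C : qcat) (g g' : cell1 (B : qCat2) (C : qCat2)) (b : hom g g')
    (u : cell1 (A : qCat2) (B : qCat2)) :
  pack (whiskr b u) = pack (fmap (hmap (@sprecomp A B C u)) b).
Proof.
by have := congr1 (fun F : functor (h (sexp C B)) _ => pack (fmap F b)) (@hcomp1_precomp A B C u).
Qed.

Section JoyalTransformation.
Variables (A : sSet) (t : A 0).
Hypothesis tT : joyal_terminal t.

Let cst n : A n := act (om_const n ord0) t.

Let act_cst m n (f : ordmap m n) : act f (cst n) = cst m.
Proof. by rewrite /cst -act_comp; congr act; apply: om0_eq. Qed.

(** The prescriptions are the two ends of the homotopy and its stationarity at [t]; [E] imposes them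
    on all faces and degeneracies, to be stable under [act]. *)
Let E0 n (x : sprod A (Delta 1) n) (z : A n) : Prop :=
  [/\ (forall j, x.2 j = 0 :> nat) -> z = x.1,
      (forall j, x.2 j = 1 :> nat) -> z = cst n &
      x.1 = cst n -> z = cst n].
Let E n (x : sprod A (Delta 1) n) (z : A n) : Prop :=
  forall m (f : ordmap m n), E0 (act f x) (act f z).

Let E_surj m n (f : ordmap m n) x z : ~ in_boundary (f : Delta n m) -> E0 x z ->
  E0 (act f x) (act f z).
Proof.
move=> f_surj [x0 x1 xt]; have f_sec j0 : exists j, f j = j0.
  by apply: contrapT => /forallNP no; apply: f_surj; exists j0.
split=> [u0|u1|at'].
- by rewrite x0 // => j; have [k <-] := f_sec j; apply: u0.
- by rewrite x1 // => j; have [k <-] := f_sec j; apply: u1.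
have [d fd _] := om_section ord0 f_surj.
by rewrite xt // -[x.1]act_id -fd act_comp [act f _]at' act_cst.
Qed.

Lemma joyal_transformation : exists H : smap (sprod A (Delta 1)) A,
  [/\ forall n (a : A n), H n (a, om_const n ord0) = a,
      forall n (a : A n), H n (a, om_const n ord_max) = act (om_const n ord0) t &
      forall n (u : Delta 1 n), H n (act (om_const n ord0) t, u) = act (om_const n ord0) t].
Proof.
have [|||H HE] := @section_of_trivial_fibration (sprod A (Delta 1)) A E.
- by move=> m n f x z xz p g; rewrite -!act_comp; apply: xz.
- move=> [a u]; exists (if u ord0 == ord0 then a else t) => m f.
  apply: E_surj; first exact: boundary0.
  have ct : cst 0 = t by apply: act00.
  split=> /= [u0|u1|]; last by move=> ->; rewrite ct; case: ifP.
    by have -> : u ord0 == ord0 by apply/eqP/val_inj/u0.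
  by case: eqP => [e|_]; [have := u1 ord0; rewrite e | rewrite ct].
- move=> n [a u] y cy yE.
  suff [z xz zy] : exists2 z, E0 (a, u) z & forall i, i <= n.+1 -> dface i z = y i.
    exists z; split=> // m f; case: (pselect (in_boundary (f : Delta n.+1 m))).
      move=> /om_boundary_factor [i [v [lei ->]]]; rewrite !act_comp -!/(dface i _) zy //.
      exact: yE.
    by move=> f_surj; apply: E_surj.
  have yE0 i : i <= n.+1 -> E0 (dface i ((a, u) : sprod A (Delta 1) n.+1)) (y i).
    by move=> lei; have := yE i lei n (om_id n); rewrite !act_id.
  case: (pselect (forall j, u j = 0 :> nat)) => [u0|u0].
    exists a; first by split=> //= u1; have := u1 ord0; rewrite u0.
    by move=> i lei; have [-> //] := yE0 i lei => j; apply: u0.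
  case: (pselect (forall j, u j = 1 :> nat)) => [u1|u1].
    exists (cst n.+1) => [|i lei]; first by split=> //= u0'; have := u1 ord0; rewrite u0'.
    by rewrite [LHS]act_cst; have [_ -> //] := yE0 i lei => j; apply: u1.
  case: (pselect (a = cst n.+1)) => [at'|at'].
    exists (cst n.+1) => [|i lei]; first by split; rewrite /= ?at'.
    by rewrite [LHS]act_cst; have [_ _ ->] := yE0 i lei; rewrite //= at' act_cst.
  (* The cell is not wholly over 0, so its last vertex lies over 1 and the sphere ends at [t]. *)
  have [|z zy] := (joyal_terminalP t).1 tT n y cy; last by exists z => //; split.
  have [_ e _] := yE 0 isT 0 (om_const 0 ord_max); rewrite e; first exact: act00.
  move=> j /=; apply: contrapT => u01; apply: u0 => k; move: u01.
  set l := (X in u X) => u01; have := @ordfun_mono _ _ u k l; have := ltn_ord (u l).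
  have : k <= l by rewrite /= /bump -ltnS.
  lia.
exists H; split=> [n a|n a|n u].
- by have [e _ _] := HE n (a, om_const n ord0) n (om_id n); rewrite !act_id in e; apply: e.
- by have [_ e _] := HE n (a, om_const n ord_max) n (om_id n); rewrite !act_id in e; apply: e.
- have [_ _] := HE n (act (om_const n ord0) t, u) n (om_id n); rewrite /= !act_id.
  by apply.
Qed.
End JoyalTransformation.

Lemma joyal_terminal_adjunction (A : qcat) (t : qcarrier A 0) : joyal_terminal t ->
  adjunction (qfunctor (A := A) (B := qpt) (bang A)) (qfunctor (A := qpt) (B := A) (yoneda t)).
Proof.
move=> tT; have [H [H0 H1 Ht]] := joyal_transformation tT.
set f := qfunctor (A := A) (B := qpt) (bang A); set u := qfunctor (A := qpt) (B := A) (yoneda t).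
have e_src : face ord_max (H : sexp A A 1) = sid1 A.
  apply: smap_ext => n [a s] /=; rewrite -[RHS](H0 n a); congr (H _ (_, _)).
  by apply: ordmap_ext => j; rewrite /= [s j]ord1; apply: val_inj.
have e_tgt : face ord0 (H : sexp A A 1) = comp1_ob u f.
  apply: smap_ext => n [a s] /=; rewrite -(H1 n a); congr (H _ (_, _)).
  by apply: ordmap_ext => j; rewrite /= [s j]ord1; apply: val_inj.
pose eta : edge (sid1 A) (comp1_ob u f) := exist _ (H : sexp A A 1) (conj e_src e_tgt).
have e_pt : comp1_ob f u = id1 (qpt : qCat2) by apply: sexp_pt_thin.
exists (hclass (HGen eta)), (eq_hom e_pt).
split; first by apply: (@hom_thin (sexp (Delta 0) A)); apply: sexp_pt_thin.
apply: pack_inj.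
(* Only the unit whiskered by [t] is left: the restriction of [H] to [t], a degenerate edge. *)
rewrite (pack_compm_idr _ (pack_eq_hom _)).
rewrite (pack_compm_idr _ (pack_whiskl_id _ (pack_eq_hom _))).
rewrite (pack_compm_idr _ (pack_eq_hom _)) (pack_compm_idl _ (pack_eq_hom _)).
rewrite pack_whiskr_qCat2 [fmap _ _]hmap_gen; apply: pack_edge_degen.
apply: smap_ext => n [a s] /=; rewrite (om0_eq a (om_const n ord0)) Ht.
by congr act; apply: om0_eq.
Qed.

(** * Slices and lifting of natural transformations *)

Program Definition om_cone m n (f : ordmap m n) : ordmap m.+1 n.+1 :=
  @OrdMap m.+1 n.+1
    (fun j => if (j : nat) <= m then widen_ord (leqnSn _) (f (inord j)) else ord_max) _.
Next Obligation.
move=> m n f j k jk /=; case: (leqP k m) => km; last by case: ifP => //= _; apply: ltnW.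
by rewrite (leq_trans jk km) /=; apply: ordfun_mono; rewrite !inordK ?ltnS // (leq_trans jk).
Qed.

Lemma om_coneE m n (f : ordmap m n) (j : 'I_m.+2) :
  om_cone f j = (if (j : nat) <= m then f (inord j) : nat else n.+1) :> nat.
Proof. by rewrite /=; case: ifP. Qed.

Lemma om_cone_omd n i : i <= n.+1 -> om_cone (omd n i) = omd n.+1 i.
Proof.
move=> lei; apply: ordmap_ext_nat => j; rewrite om_coneE /=.
have := ltn_ord j; rewrite /bump; case: (leqP j n) => lej; last by lia.
by rewrite inordK.
Qed.

(** The decalage, in which the last vertex of a simplex is kept as a cone point; [slice] is its part
    with cone point [t]. *)
Program Definition Dec (A : sSet) : sSet :=
  @SSet (fun n => A n.+1) (fun _ _ f x => act (om_cone f) x) _ _.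
Next Obligation.
move=> A n x; rewrite -[RHS]act_id; apply: act_ext => j; rewrite om_coneE /=.
by have := ltn_ord j; case: (leqP j n) => lej; [rewrite inordK | lia].
Qed.
Next Obligation.
move=> A m n p g f x /=; rewrite -act_comp; apply: act_ext => j.
have e := om_coneE f j; have := ltn_ord (f (inord j)).
rewrite [LHS]om_coneE [RHS]om_coneE e.
case: (leqP j m) => [lej lf|_ _]; last by rewrite ltnn.
by rewrite -ltnS lf /= inord_val.
Qed.

Lemma dface_Dec (A : sSet) n i (x : Dec A n.+1) : i <= n.+1 ->
  dface i x = dface i (x : A n.+2).
Proof. by move=> lei; rewrite /dface /= om_cone_omd. Qed.

Section Slice.
Variables (A : sSet) (t : A 0).

Definition ends_at n (x : Dec A n) : Prop := act (om_const 0 ord_max) (x : A n.+1) = t.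

Lemma ends_at_act m n (f : ordmap m n) (x : Dec A n) : ends_at x -> ends_at (act f x).
Proof.
rewrite /ends_at /= -act_comp => <-; apply: act_ext => j.
by rewrite [LHS]om_coneE /= ltnn.
Qed.

Definition slice : sSet := subcomplex ends_at_act.

Program Definition sproj : smap slice A :=
  @SMap slice A (fun n z => dface n.+1 (sval z : A n.+1)) _.
Next Obligation.
move=> m n f [z zt]; rewrite /= /dface -!act_comp; apply: act_ext => j.
rewrite [LHS]om_coneE /= !/bump; have := ltn_ord j; have := ltn_ord (f j).
rewrite !ltnS => lfj lej; rewrite !(leqNgt n.+1) (leqNgt m.+1) !ltnS lej lfj /= !add0n lej.
by congr (nat_of_ord (f _)); apply: val_inj; rewrite /= inordK.
Qed.

Lemma dface_slice n i (z : slice n.+1) : i <= n.+1 ->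
  sval (dface i z) = dface i (sval z : A n.+2).
Proof. by move=> lei; rewrite -dface_Dec. Qed.

Lemma slice_inj n (y z : slice n) : sval y = sval z :> A n.+1 -> y = z.
Proof. by case: y z => y yt [z zt] /= e; apply: eq_exist. Qed.

Hypothesis qA : is_quasicategory A.

(* A right horn of the slice is, after adding the cone point, an inner horn of [A]. *)
Lemma slice_right_fill n k (y : nat -> slice n) (a : A n.+1) : 0 < k <= n.+1 ->
  compat (predC1 k) y ->
  (forall i, i <= n.+1 -> i != k -> sproj n (y i) = dface i a) ->
  exists z : slice n.+1, sproj n.+1 z = a /\
    forall i, i <= n.+1 -> i != k -> dface i z = y i.
Proof.
move=> k_in cy ya; pose Y i : A n.+1 := if i <= n.+1 then sval (y i) else a.
have [||b bY] := inner_fill qA (k := k) (y := Y); first by lia.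
  move=> i j /= ik jk ij lej; rewrite {2}/Y (_ : i <= n.+1); last by lia.
  rewrite /Y; case: leqP => [lej1|]; last first.
    move=> gtj; have -> : j.-1 = n.+1 by lia.
    by rewrite -ya //; lia.
  case: n => [|n] in y a k_in cy ya Y lej lej1 *; first by lia.
  by rewrite -!dface_slice; [rewrite cy | lia | lia].
have b_ends : ends_at b.
  have := proj2_sig (y 0); rewrite /ends_at => <-.
  have -> : sval (y 0) = dface 0 b :> A n.+1 by rewrite bY //; lia.
  rewrite /dface -act_comp; apply: act_ext => j /=.
  by rewrite /bump; lia.
exists (exist _ b b_ends); split=> [|i lei ik].
  by rewrite /= bY //; [rewrite /Y ltnn | lia].
by apply: slice_inj; rewrite dface_slice //= bY /Y ?lei //; lia.
Qed.

(** * Extending lifts from open boxes to prisms *)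

Section Prism.

Definition lies_over (X : sSet) (b : smap X A) (R : forall n, X n -> slice n -> Prop) : Prop :=
  forall n x z, R n x z -> sproj n z = b n x.

(** Filling the right horn over [b] in the slice lifts [x]. The missing face is adjoined before [x],
    its own faces lying in the horn. *)
Lemma right_horn_attach (X : sSet) (b : smap X A) R n k (x : X n.+1) :
  partial_map R -> lies_over b R -> 0 < k <= n.+1 ->
  (forall i, i != k -> i <= n.+1 -> pdom R (dface i x)) -> ~ pdom R (dface k x) ->
  exists R', [/\ partial_map R', lies_over b R', forall m y z, R m y z -> R' m y z,
    pdom R' x & forall m (y : X m), pdom R' y -> pdom R y \/ exists s, y = act s x].
Proof.
move=> pR bR k_in xR xkR.
have [|y xy] := @pdom_faces _ _ R n x (predC1 k) _ xR.
  by have [|z] := xR 0 _ isT; [lia | exists z].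
have cy := partial_map_compat pR xy.
have [|z [zb zy]] := slice_right_fill (a := b n.+1 x) k_in cy.
  by move=> i lei ik; rewrite -sapp_dface; apply: bR; apply: xy.
have xz i : i != k -> i <= n.+1 -> R n (dface i x) (dface i z).
  by move=> ik lei; rewrite zy //; apply: xy.
pose R1 := attach R (dface k x) (dface k z).
have pR1 : partial_map R1.
  case: n => [|n] in x k_in xR xkR y xy cy z zb zy xz R1 *.
    by apply: attach_partial_map => // m s /boundary0.
  apply: attach_faces => // i lei; case: (ltnP i k) => ik.
    by rewrite !(dface_dface _ ik); apply: pR.2; apply: xz; lia.
  have {}ik : k < i.+1 by [].
  by rewrite -!(dface_dface _ ik); apply: pR.2; apply: xz; lia.
have bR1 : lies_over b R1.
  by move=> m _ _ [/bR //|[s [-> ->]]]; rewrite !sapp_act zb.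
have R1x m (w : X m) : pdom R1 w -> pdom R w \/ exists s, w = act s x.
  case=> v [wv|[s [-> _]]]; first by left; exists v.
  by right; exists (om_comp (omd n k) s); rewrite act_comp.
case: (pselect (pdom R1 x)) => xR1; first by exists R1; split=> // m w v; left.
exists (attach R1 x z); split.
- apply: attach_faces => // i lei; case: (eqVneq i k) => [->|ik]; last by left; apply: xz.
  by right; exists (om_id n); rewrite !act_id.
- by move=> m _ _ [/bR1 //|[s [-> ->]]]; rewrite !sapp_act zb.
- by move=> m w v wv; left; left.
- by exists z; right; exists (om_id n.+1); rewrite !act_id.
move=> m w [v [wv|[s [-> _]]]]; last by right; exists s.
by apply: R1x; exists v.
Qed.

Variable n : nat.

(* The [i]-th top simplex of the prism passes (0,0), .., (0,i), (1,i), .., (1,n). *)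
Program Definition prism_simplex (i : nat) : sprod (Delta 1) (Delta n) n.+1 :=
  (@OrdMap n.+1 1 (fun j => inord (i < j)) _,
   @OrdMap n.+1 n (fun j => inord (minn n (j - (i < j)))) _).
Next Obligation. by move=> i j k jk; rewrite !inordK; lia. Qed.
Next Obligation.
move=> i j k jk; have := ltn_ord j; have := ltn_ord k => lk lj /=.
by rewrite !val_inord; [|lia|lia]; lia.
Qed.

(** For i <= n these are exactly the faces and degeneracies of the i-th top simplex, described
    through their vertices. *)
Definition below_prism (i m : nat) (x : sprod (Delta 1) (Delta n) m) : Prop :=
  forall k, (x.1 k = 0 :> nat -> x.2 k <= i) /\ (x.1 k = 1 :> nat -> i <= x.2 k).

Lemma below_prism_act i m (x : sprod (Delta 1) (Delta n) m) : below_prism i x ->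
  exists f : ordmap m n.+1, x = act f (prism_simplex i).
Proof.
(* The vertex (u, s) stands at position s + u on the path. *)
case: x => u s us; have b k : s k + u k < n.+2.
  by have := ltn_ord (s k); have := ltn_ord (u k); lia.
have mono (j k : 'I_m.+1) : j <= k -> Ordinal (b j) <= Ordinal (b k).
  by move=> jk /=; apply: leq_add; apply: ordfun_mono.
exists (OrdMap mono); congr pair; apply: ordmap_ext_nat => k /=; move: (us k) => /= [u0 u1];
  have := ltn_ord (s k); have := ltn_ord (u k); rewrite val_inord; lia.
Qed.

Lemma prism_simplex_below i m (f : ordmap m n.+1) : i <= n ->
  below_prism i (act f (prism_simplex i)).
Proof.
move=> lei k /=; have := ltn_ord (f k); rewrite !val_inord; [|lia|lia].
by split; lia.
Qed.

Definition on_open_box m (x : sprod (Delta 1) (Delta n) m) : Prop :=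
  in_boundary (x.2 : Delta n m) \/ forall k, x.1 k = 1 :> nat.

(** Omitting the only vertex of a column lands in the boundary. Omitting (0,i) lands in the end over
    1 if i = 0, and in the preceding top simplex otherwise. *)
Lemma prism_simplex_face i l : i <= n -> l <= n.+1 -> l != i.+1 ->
  let x := dface l (prism_simplex i) in on_open_box x \/ exists j, j < i /\ below_prism j x.
Proof.
move=> lei lel li x; have x1 k : x.1 k = (i < bump l k) :> nat by rewrite /= val_inord //; lia.
have x2 k : x.2 k = bump l k - (i < bump l k) :> nat.
  have := ltn_ord k; rewrite /= val_inord /bump; lia.
case: (ltngtP l i) => [lt_li|gt_li|e].
- left; left; exists (inord l) => k /(congr1 (@nat_of_ord _)).
  by rewrite x2 val_inord; rewrite /bump; lia.
- left; left; exists (inord l.-1) => k /(congr1 (@nat_of_ord _)).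
  by rewrite x2 val_inord; rewrite /bump; lia.
subst l; case: i lei lel li x x1 x2 => [|i] lei lel li x x1 x2.
  by left; right => k; rewrite x1 /bump; lia.
right; exists i; split=> // k; rewrite x1 x2 /bump; split; lia.
Qed.

(** Without (1,i) the path still meets every column and contains (0,i), which no earlier top simplex
    does. *)
Lemma prism_simplex_inner i : i <= n ->
  let x := dface i.+1 (prism_simplex i) in
  ~ on_open_box x /\ forall j, j < i -> ~ below_prism j x.
Proof.
move=> lei x; have x1 k : x.1 k = (i < k) :> nat.
  by rewrite /= val_inord /bump //; lia.
have x2 k : x.2 k = k :> nat.
  by have := ltn_ord k; rewrite /= val_inord /bump; lia.
split=> [[[l /(_ l)]|/(_ ord0)]|j ji /(_ (inord i)) []].
- by case; apply: val_inj; apply: x2.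
- by rewrite x1.
by rewrite x1 x2 val_inord //; lia.
Qed.

Lemma prism_covered m (x : sprod (Delta 1) (Delta n) m) :
  on_open_box x \/ exists j, j <= n /\ below_prism j x.
Proof.
case: (pselect (forall k, x.1 k = 1 :> nat)) => [|/existsNP [k0 k0x]]; first by left; right.
right; have k0x0 : x.1 k0 == ord0 by move: k0x; case: (x.1 k0) => [[|[|//]] ?].
have [k1 k1x k1_max] := @arg_maxnP _ k0 (fun k => x.1 k == ord0) (fun k => k) k0x0.
exists (x.2 k1); split=> [|k]; first by rewrite -ltnS.
split=> xk; apply: ordfun_mono; first by apply: k1_max; apply/eqP/val_inj.
rewrite leqNgt; apply/negP => /ltnW /(ordfun_mono x.1); rewrite xk.
by move/eqP: k1x => ->.
Qed.

(** The top simplices are adjoined in increasing order. All faces of the i-th one but face i+1 are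
    present by then, which is a right horn. *)
Lemma prism_fill (b : smap (sprod (Delta 1) (Delta n)) A) R :
  partial_map R -> lies_over b R -> (forall m x, @pdom _ _ R m x <-> on_open_box x) ->
  exists f : smap (sprod (Delta 1) (Delta n)) slice,
    (forall m x, sproj m (f m x) = b m x) /\ forall m x z, R m x z -> z = f m x.
Proof.
move=> pR bR R_dom.
suff /(_ n.+1) [//|R' [pR' bR' RR' R'_dom]] : forall i, i <= n.+1 -> exists R',
    [/\ partial_map R', lies_over b R', forall m x z, R m x z -> R' m x z &
    forall m x, @pdom _ _ R' m x <-> on_open_box x \/ exists j, j < i /\ below_prism j x].
  have [m x|f fR'] := partial_map_total pR'.
    apply/R'_dom; case: (prism_covered x) => [|[j [lej jx]]]; first by left.
    by right; exists j.
  exists f; split=> [m x|m x z /RR' xz]; first exact/bR'/fR'.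
  exact: pR'.1 xz (fR' _ _).
elim=> [|i IHi] lei.
  exists R; split=> // m x; rewrite R_dom; split; first by left.
  by case=> // -[j []].
have [R1 [pR1 bR1 RR1 R1_dom]] := IHi (ltnW lei).
have [|||R' [pR' bR' R1R' R'x R'_dom]] :=
    @right_horn_attach _ b R1 n i.+1 (prism_simplex i) pR1 bR1; first by lia.
- by move=> l li lel; apply/R1_dom/prism_simplex_face.
- move=> /R1_dom; have [no_box no_below] := prism_simplex_inner lei.
  by case=> // -[j [ji]]; apply: no_below.
exists R'; split=> // [m x z /RR1/R1R'//|m x]; split=> [/R'_dom|].
  case=> [/R1_dom [|[j [ji jx]]]|[s ->]]; first by left.
    by right; exists j; split=> //; apply: ltnW.
  by right; exists i; split=> //; apply: prism_simplex_below.
have R1_R' y : @pdom _ _ R1 m y -> pdom R' y by case=> z /R1R' yz; exists z.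
case=> [box|[j []]]; first by apply/R1_R'/R1_dom; left.
rewrite ltnS leq_eqVlt => /orP [/eqP-> /below_prism_act [s ->]|ji jx].
  by have [z xz] := R'x; exists (act s z); apply: pR'.2.
by apply/R1_R'/R1_dom; right; exists j.
Qed.
End Prism.

Section LiftTransformation.
Variables (X : sSet) (H : sexp A X 1) (g : smap X slice).
Hypothesis gH : forall n (x : X n), sproj n (g n x) = H n (x, om_const n ord_max).

(** The lift is sought as a map from [X] to the paths in the slice: over [x] lie the lifts of [H] to
    the prism of [x] that end with [g]. *)
Let Z := sexp slice (Delta 1).
Let E n (x : X n) (z : Z n) : Prop :=
  (forall m (u : Delta 1 m) (s : Delta n m), sproj m (z m (u, s)) = H m (act s x, u)) /\
  (forall m (s : Delta n m), z m (om_const m ord_max, s) = g m (act s x)).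

Program Definition prism_map n (x : X n) : smap (sprod (Delta 1) (Delta n)) A :=
  @SMap (sprod (Delta 1) (Delta n)) A (fun m a => H m (act a.2 x, a.1)) _.
Next Obligation.
by move=> n x m p f [u s] /=; rewrite -(sapp_act H) /= act_comp.
Qed.

Let lift_cell n (x : X n) (B : forall m, sprod (Delta 1) (Delta n) m -> slice m -> Prop) :
  partial_map B -> lies_over (prism_map x) B ->
  (forall m a, pdom B a <-> in_boundary (a.2 : Delta n m)) ->
  (forall m (s : Delta n m) z, B m (om_const m ord_max, s) z -> z = g m (act s x)) ->
  exists z : Z n, E x z /\ forall m a w, B m a w -> w = z m a.
Proof.
move=> pB bB B_dom Bg.
pose R m (a : sprod (Delta 1) (Delta n) m) w :=
  B m a w \/ a.1 = om_const m ord_max /\ w = g m (act a.2 x).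
have [|||z [zb zR]] := @prism_fill n (prism_map x) R.
- split=> [m [u s] w w' [aw|/= [-> ->]] [aw'|/= [e ->]]|m p f [u s] w [aw|/= [-> ->]]].
  + exact: pB.1 aw aw'.
  + by move: aw; rewrite e => /Bg.
  + by symmetry; apply: Bg.
  + by [].
  + by left; apply: pB.2 aw.
  + right; split; first exact: ordmap_ext.
    by rewrite [RHS]/= [act (om_comp s f) x]act_comp; apply: (esym (sapp_act g f _)).
- by move=> m [u s] w [/bB //|[/= -> ->]]; apply: gH.
- move=> m [u s]; split=> [[w [aw|[/= -> _]]]|[/= bs|/= u1]].
  + by left; apply/B_dom; exists w.
  + by right.
  + by have /B_dom [w aw] : in_boundary ((u, s).2 : Delta n m) by []; exists w; left.
  + exists (g m (act s x)); right; split=> //; apply: ordmap_ext_nat => j /=.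
    exact: u1.
exists z; split; last by move=> m a w aw; apply: zR; left.
split=> [m u s|m s]; first exact: zb.
by symmetry; apply: zR; right.
Qed.

Lemma lift_transformation : exists f : smap X slice,
  (forall n (x : X n), sproj n (f n x) = H n (x, om_const n ord0)) /\
  forall x : X 0, exists s : A 2, [/\ dface 2 s = H 1 (act (om_const 1 ord0) x, om_id 1),
    dface 0 s = sval (g 0 x) & dface 1 s = sval (f 0 x)].
Proof.
have [|||F FE] := @section_of_trivial_fibration X Z E.
- move=> m n f x z [zH zg]; split=> [p u s|p s].
    by rewrite -act_comp; apply: zH.
  by rewrite -act_comp; apply: zg.
- move=> x; have [||||z [xz _]] := @lift_cell 0 x (fun _ _ _ => False).
  + by [].
  + by [].
  + by move=> m a; split=> [[]|/boundary0].
  + by [].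
  by exists z.
- move=> n x y cy yE.
  pose B m (a : sprod (Delta 1) (Delta n.+1) m) w := exists i (v : ordmap m n),
    [/\ i <= n.+1, a.2 = om_comp (omd n i) v & w = y i m (a.1, v)].
  have [||||z [xz zB]] := @lift_cell n.+1 x B.
  + split=> [m [u s] w w' [i [v [/= lei sv ->]]] [j [v' [/= lej sv' ->]]]|m p f [u s] w].
      rewrite sv in sv'; have := compat_act cy isT isT lei lej sv'.
      move/(congr1 (fun h : Z m => h m (u, om_id m))) => /=.
      have e (k : ordmap m n) : om_comp k (om_id m) = k by apply: ordmap_ext.
      by rewrite !e.
    move=> [i [v [/= lei -> ->]]]; exists i, (om_comp v f); split=> //.
    exact: (esym (sapp_act (y i) f (u, v))).
  + move=> m [u s] w [i [v [/= lei -> ->]]]; have := (yE i lei).1 m u v.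
    by rewrite /dface -act_comp.
  + move=> m [u s]; split=> [[w [i [v [/= lei -> _]]]]|/om_boundary_factor [i [v [lei sv]]]].
      exact: (in_boundary_act _ (omd_boundary lei)).
    by exists (y i m (u, v)), i, v.
  + move=> m s w [i [v [/= lei -> ->]]]; have := (yE i lei).2 m v.
    by rewrite /dface -act_comp.
  exists z; split=> // i lei; apply: smap_ext => m [u s] /=.
  symmetry; apply: zB; by exists i, s.
pose f n (x : X n) := F n x n (om_const n ord0, om_id n).
have f_act m n (h : ordmap m n) (x : X n) : f m (act h x) = act h (f n x).
  rewrite /f sapp_act -(sapp_act (F n x)) /=; congr (F n x m (_, _)); exact: ordmap_ext.
exists (SMap f_act); split=> [n x|x].
  by have := (FE n x).1 n (om_const n ord0) (om_id n); rewrite act_id.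
pose s : slice 1 := F 0 x 1 (om_id 1, om_const 1 ord0).
have sface i (u : Delta 1 0) : i <= 1 -> om_comp (om_id 1) (omd 0 i) = u ->
    dface i (sval s : A 2) = sval (F 0 x 0 (u, om_id 0)).
  move=> lei <-; rewrite -dface_slice // /dface -(sapp_act (F 0 x)) /=.
  congr (sval (F 0 x 0 (_, _))).
  exact: om0_eq.
exists (sval s); split.
- exact: (FE 0 x).1 1 (om_id 1) (om_const 1 ord0).
- rewrite (sface 0 (om_const 0 ord_max)) //.
    by have := (FE 0 x).2 0 (om_id 0); rewrite act_id => ->.
  by apply: ordmap_ext_nat => j; rewrite [j]ord1.
rewrite (sface 1 (om_const 0 ord0)) //.
by apply: ordmap_ext_nat => j; rewrite [j]ord1.
Qed.
End LiftTransformation.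
End Slice.

(** * Lifting along paths of natural transformations *)

Section HtermMap.
Variables (X Y : sSet) (f : smap X Y).

Fixpoint hterm_map (x y : X 0) (p : hterm x y) : hterm (f 0 x) (f 0 y) :=
  match p with
  | HGen _ _ e => HGen (edge_map f e)
  | HId x => HId (f 0 x)
  | HComp _ _ _ p q => HComp (hterm_map p) (hterm_map q)
  end.

Lemma hmap_hclass (x y : X 0) (p : hterm x y) :
  @fmap _ _ (hmap f) x y (hclass p) = hclass (hterm_map p).
Proof.
elim: p => {x y} [x y e|x|x y z p IHp q IHq]; first exact: hmap_gen.
  exact: (fmap1 (hmap f) x).
by rewrite -hclassM fmapM IHp IHq hclassM.
Qed.
End HtermMap.

(** * Comparing cones along words of edges *)

Section Triangles.
Variable A : sSet.

(** The 2-simplex exhibits [a] as a composite of [e] followed by [b]. *)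
Definition triangle (e a b : A 1) : Prop :=
  exists s : A 2, [/\ dface 2 s = e, dface 0 s = b & dface 1 s = a].

(* Composing [p] with [b] in the homotopy category gives [a]: this makes sense without *)
(* quotients, identities acting as the homotopy relation.                              *)
Fixpoint triangle_along (x y : A 0) (p : hterm x y) : A 1 -> A 1 -> Prop :=
  match p with
  | HGen _ _ e => triangle (sval e)
  | HId x => triangle (degen0 x)
  | HComp _ _ _ p q => fun a c => exists b, triangle_along p a b /\ triangle_along q b c
  end.

Hypothesis qA : is_quasicategory A.

(** Both directions complete a 3-simplex whose last face is [s]: the inner horn missing face 1 gives
    the composite, the one missing face 2 the factorization. *)
Lemma triangle_comp (s : A 2) a c :
  (exists b, triangle (dface 2 s) a b /\ triangle (dface 0 s) b c) <-> triangle (dface 1 s) a c.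
Proof.
split=> [[b [[s1 [s12 s10 s11]] [s2 [s22 s20 s21]]]]|[r [r2 r0 r1]]].
  pose y i := if i == 0 then s2 else if i == 2 then s1 else s.
  have [|w wy] := inner_fill qA (k := 1) (y := y) isT.
    move=> [|[|[|i]]] [|[|[|[|j]]]] //= _ _ _ _; rewrite /y /= ?s10 ?s21 ?s22 ?s12 //.
  exists (dface 1 w); split.
  - by rewrite -(@dface_dface A _ 1 3) // wy.
  - by rewrite (@dface_dface A _ 0 1) //= wy.
  - by rewrite -(@dface_dface A _ 1 2) // wy.
have [|s2 s2y] := inner_fill qA (k := 1) (y := fun i => if i == 0 then c else dface 0 s) isT.
  move=> [|[|i]] [|[|[|j]]] //= _ _ _ _.
  by rewrite -r0 -[RHS](@dface_dface A _ 0 2) // r2 (@dface_dface A _ 0 1).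
have [s20 s22] : dface 0 s2 = c /\ dface 2 s2 = dface 0 s by rewrite !s2y.
pose y i := if i == 0 then s2 else if i == 1 then r else s.
have [|w wy] := inner_fill qA (k := 2) (y := y) isT.
  move=> [|[|[|i]]] [|[|[|[|j]]]] //= _ _ _ _; rewrite /y /= ?s20 ?s22 ?r0 ?r2 //.
exists (dface 1 s2); split; last by exists s2.
exists (dface 2 w); split.
- by rewrite -(@dface_dface A _ 2 3) // wy.
- by rewrite (@dface_dface A _ 0 2) //= wy.
- by rewrite (@dface_dface A _ 1 2) //= wy.
Qed.

Lemma dface_gt (e : A 1) :
  [/\ dface 2 (act (om_gt 0) e) = e, dface 0 (act (om_gt 0) e) = degen0 (dface 0 e) &
      dface 1 (act (om_gt 0) e) = e] /\
  [/\ dface 2 (act (om_gt 1) e) = degen0 (dface 1 e), dface 0 (act (om_gt 1) e) = e &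
      dface 1 (act (om_gt 1) e) = e].
Proof. by have := face_gt e; rewrite !face_dface. Qed.

Lemma edge_src (x y : A 0) (e : edge x y) : dface 1 (sval e) = x.
Proof. by have [ex _] := proj2_sig e; rewrite -[RHS]ex face_dface. Qed.
Lemma edge_tgt (x y : A 0) (e : edge x y) : dface 0 (sval e) = y.
Proof. by have [_ ey] := proj2_sig e; rewrite -[RHS]ey face_dface. Qed.

Lemma triangle_idl (e a c : A 1) :
  (exists b, triangle (degen0 (dface 1 e)) a b /\ triangle e b c) <-> triangle e a c.
Proof.
have [_ [e2 e0 e1]] := dface_gt e.
by have := triangle_comp (act (om_gt 1) e) a c; rewrite e2 e0 e1.
Qed.

Lemma triangle_idr (e a c : A 1) :
  (exists b, triangle e a b /\ triangle (degen0 (dface 0 e)) b c) <-> triangle e a c.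
Proof.
have [[e2 e0 e1] _] := dface_gt e.
by have := triangle_comp (act (om_gt 0) e) a c; rewrite e2 e0 e1.
Qed.

Lemma dface_degen0 i (x : A 0) : dface i (degen0 x) = x.
Proof. by rewrite /dface /degen0 -act_comp act00. Qed.

Lemma triangle_along_idl (x y : A 0) (p : hterm x y) a c :
  triangle_along (HComp (HId x) p) a c <-> triangle_along p a c.
Proof.
elim: p a c => {x y} [x y e|x|x y z p IHp q IHq] a c /=.
- by have := triangle_idl (sval e) a c; rewrite edge_src.
- by have := triangle_idl (degen0 x) a c; rewrite dface_degen0.
split=> [[b [ab [b' [bb' b'c]]]]|[b [/IHp [b' [ab' b'b]] bc]]].
  by exists b'; split=> //; apply/IHp; exists b.
by exists b'; split=> //; exists b.
Qed.

Lemma triangle_along_idr (x y : A 0) (p : hterm x y) a c :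
  triangle_along (HComp p (HId y)) a c <-> triangle_along p a c.
Proof.
elim: p a c => {x y} [x y e|x|x y z p IHp q IHq] a c /=.
- by have := triangle_idr (sval e) a c; rewrite edge_tgt.
- by have := triangle_idr (degen0 x) a c; rewrite dface_degen0.
split=> [[b [[b' [ab' b'b]] bc]]|[b [ab /IHq [b' [bb' b'c]]]]].
  by exists b'; split=> //; apply/IHq; exists b.
by exists b'; split=> //; exists b.
Qed.

Lemma triangle_along_hrel (x y : A 0) (p q : hterm x y) : hrel p q ->
  forall a c, triangle_along p a c <-> triangle_along q a c.
Proof.
elim=> {x y p q}.
- by move=> x e ex a c /=; rewrite ex.
- move=> s x y z e f g es fs gs a c /=; rewrite es fs gs !face_dface.
  exact: triangle_comp.
- exact: triangle_along_idl.
- exact: triangle_along_idr.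
- move=> x y z v p q r a c /=.
  split=> [[b [ab [b' [bb' b'c]]]]|[b' [[b [ab bb']] b'c]]].
    by exists b'; split=> //; exists b.
  by exists b; split=> //; exists b'.
- move=> x y z p p' q q' _ IHp _ IHq a c /=.
  by split=> -[b [/IHp ab /IHq bc]]; exists b.
- by [].
- by move=> x y p q _ IH a c; split=> /IH.
by move=> x y p q r _ IHpq _ IHqr a c; split=> [/IHpq/IHqr|/IHqr/IHpq].
Qed.

Lemma triangle_along_id (x y v : A 0) (p : hterm x y) a c :
  @pack (h A) x y (hclass p) = @pack (h A) v v (idm (v : h A)) ->
  triangle_along p a c -> triangle (degen0 v) a c.
Proof.
move=> e; move: (pack_src e) (pack_tgt e) => ex ey; subst.
by move/pack_inj/hclassP: e => /triangle_along_hrel ->.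
Qed.

(** The homotopy is itself a 2-simplex with third edge [e], to which [triangle_comp] applies. *)
Lemma triangle_degen (v : A 0) e : triangle (degen0 v) e (degen0 v) ->
  triangle e (degen0 v) (degen0 v).
Proof.
move=> [s [s2 s0 <-]]; apply/triangle_comp; rewrite s2 s0.
have [_ [e2 e0 e1]] := dface_gt (degen0 v).
by exists (degen0 v); split; exists (act (om_gt 1) (degen0 v)); rewrite e2 e0 e1 dface_degen0.
Qed.
End Triangles.

Section Evaluation.
Variables (X A : sSet) (x : X 0).

Program Definition sev : smap (sexp A X) A :=
  @SMap (sexp A X) A (fun n F => F n (act (om_const n ord0) x, om_id n)) _.
Next Obligation.
by move=> m n f F; rewrite /= -(sapp_act F) /= -act_comp; congr (F m (_, _)).
Qed.
End Evaluation.

Section ConeOverPath.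
Variables (A : sSet) (t : A 0).
Hypothesis qA : is_quasicategory A.

(** Induction on the word, lifting from its target back to its source. *)
Lemma lift_path (X : sSet) (f g : sexp A X 0) (p : hterm f g) (gl : smap X (slice t)) :
  (forall n (x : X n), sproj t n (gl n x) = g n (x, om_const n ord0)) ->
  exists fl : smap X (slice t),
    (forall n (x : X n), sproj t n (fl n x) = f n (x, om_const n ord0)) /\
    forall x : X 0, triangle_along (hterm_map (sev A x) p) (sval (fl 0 x)) (sval (gl 0 x)).
Proof.
elim: p gl => {f g} [f g e|f|f1 f2 f3 p IHp q IHq] gl glg.
- have [ef eg] := proj2_sig e.
  have [|fl [flf fltri]] := @lift_transformation A t qA X (sval e) gl.
    move=> n x; rewrite glg -[in LHS]eg /=; congr (sval e n (_, _)).
    by apply: ordmap_ext_nat.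
  exists fl; split=> // n x; rewrite flf -[in RHS]ef /=; congr (sval e n (_, _)).
  by apply: ordmap_ext_nat.
- exists gl; split=> // x; rewrite /= act00 (om0_eq (om_id 0) (om_const 0 ord0)) -glg /=.
  have [_ [e2 e0 e1]] := dface_gt (sval (gl 0 x) : A 1).
  by exists (act (om_gt 1) (sval (gl 0 x) : A 1)).
have [f2l [f2lf f2tri]] := IHq gl glg; have [f1l [f1lf f1tri]] := IHp f2l f2lf.
by exists f1l; split=> // x; exists (sval (f2l 0 x)).
Qed.
End ConeOverPath.

(** * From adjunctions to terminal vertices *)

Lemma om_cone2E m n (f : ordmap m n) (j : 'I_m.+3) :
  om_cone (om_cone f) j = (if (j : nat) <= m then f (inord j) : nat else n + j - m) :> nat.
Proof.
rewrite om_coneE; have := ltn_ord j; case: (leqP j m.+1) => [lej _|gtj ltj].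
  rewrite om_coneE val_inord //; case: (leqP j m) => // gtj.
  lia.
by rewrite ifF; lia.
Qed.

Lemma om_cone3E m n (f : ordmap m n) (j : 'I_m.+4) :
  om_cone (om_cone (om_cone f)) j
  = (if (j : nat) <= m then f (inord j) : nat else n + j - m) :> nat.
Proof.
rewrite om_coneE; have := ltn_ord j; case: (leqP j m.+2) => [lej _|gtj ltj].
  by rewrite om_cone2E val_inord.
by rewrite ifF; lia.
Qed.

Program Definition om_lastdeg (n : nat) : ordmap n.+2 n.+1 :=
  @OrdMap n.+2 n.+1 (fun j => @Ordinal n.+2 (minn j n.+1) _) _.
Next Obligation. by move=> n j; lia. Qed.
Next Obligation. by move=> n j k /=; lia. Qed.

Program Definition om_last3 (n : nat) : ordmap 2 n.+3 :=
  @OrdMap 2 n.+3 (fun j => @Ordinal n.+4 (n.+1 + j) _) _.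
Next Obligation. by move=> n j; have := ltn_ord j; lia. Qed.
Next Obligation. by move=> n j k /=; lia. Qed.

(** * Filling spheres from a section of the slice projection *)

Section Retraction.
Variables (A : sSet) (t : A 0).
Hypothesis qA : is_quasicategory A.
Variable c : smap A (slice t).
Hypothesis cK : forall n (x : A n), sproj t n (c n x) = x.
Variable w : A 2.
Hypotheses (w2 : dface 2 w = sval (c 0 t) :> A 1) (w1 : dface 1 w = degen0 t).

Let cA n (x : A n) : A n.+1 := sval (c n x).

Let cA_act m n (f : ordmap m n) x : cA (act f x) = act (om_cone f) (cA x).
Proof. by rewrite /cA sapp_act. Qed.

Let cA_dface n i (x : A n.+1) : i <= n.+1 -> dface i (cA x) = cA (dface i x).
Proof. by move=> lei; rewrite {2}/dface cA_act om_cone_omd. Qed.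

Let cA_last n (x : A n) : dface n.+1 (cA x) = x.
Proof. exact: cK. Qed.

Let Z := Dec (Dec (Dec A)).
(** With w = (t, t', t''), [q] is a simplex (x_0, .., x_n, t, t', t''): omitting t'' gives the cone
    on [x], omitting t' a degenerate simplex. *)
Let E n (x : slice t n) (q : Z n) : Prop :=
  [/\ dface n.+3 (q : A n.+3) = cA (sval x : A n.+1),
      dface n.+2 (q : A n.+3) = act (om_lastdeg n) (sval x : A n.+1) &
      act (om_last3 n) (q : A n.+3) = w].

Let E_act m n (f : ordmap m n) x q : E x q -> E (act f x) (act f q).
Proof.
move=> [q3 q2 qw]; split.
- rewrite [sval _]/= cA_act -q3 /dface -!act_comp; apply: act_ext => j.
  rewrite [LHS]om_cone3E -[RHS]/(bump n.+3 (om_cone (om_cone f) j)) om_cone2E /=.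
  rewrite (_ : bump m.+3 j = j); last by have := ltn_ord j; rewrite /bump; lia.
  by have := ltn_ord j; have := ltn_ord (f (inord j)); rewrite /bump; case: (leqP j m); lia.
- rewrite [sval _]/= -act_comp.
  have -> : om_comp (om_cone f) (om_lastdeg m) = om_comp (om_lastdeg n) (om_cone (om_cone f)).
    apply: ordmap_ext_nat => j; rewrite [LHS]om_coneE.
    rewrite -[RHS]/(minn (om_cone (om_cone f) j) n.+1) om_cone2E /=.
    have := ltn_ord j; have := ltn_ord (f (inord j)).
    case: (leqP j m) => lej; last by rewrite ifF; lia.
    rewrite (_ : minn j m.+1 = j) ?lej; lia.
  rewrite act_comp -q2 /dface -!act_comp; apply: act_ext => j.
  rewrite [LHS]om_cone3E -[RHS]/(bump n.+2 (om_cone (om_cone f) j)) om_cone2E /=.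
  have := ltn_ord j; have := ltn_ord (f (inord j)).
  rewrite /bump; case: (leqP j m) => lej; last by rewrite ifF; lia.
  by rewrite (_ : (m.+2 <= j) + j = j) ?lej; lia.
rewrite -qw -act_comp; apply: act_ext => j; rewrite [LHS]om_cone3E /=.
by rewrite ifF; lia.
Qed.

(** [E] and the faces already built prescribe every face but the one opposite [t], and that horn is
    inner. *)
Lemma retraction_cells : exists Q : smap (slice t) Z, forall n x, E x (Q n x).
Proof.
apply: section_of_trivial_fibration => [|x|n x y cy yE]; first exact: E_act.
  pose y i : A 2 := if i == 0 then w else
    if i == 2 then act (om_lastdeg 0) (sval x : A 1) else cA (sval x : A 1).
  have xt : dface 0 (sval x : A 1) = t.
    by rewrite -[RHS](proj2_sig x); apply: act_ext => j; rewrite [j]ord1.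
  have [|q qy] := inner_fill qA (k := 1) (y := y) isT.
    move=> [|[|[|i]]] [|[|[|[|j]]]] //= _ _ _ _; rewrite /y /=.
    - rewrite w1 -[in RHS]xt /dface /degen0 -!act_comp; apply: act_ext => j /=.
      by rewrite /bump; have := ltn_ord j; lia.
    - by rewrite cA_dface // xt w2.
    - rewrite cA_last /dface -act_comp -[LHS](@act_id A); apply: act_ext => j /=.
      by rewrite /bump; have := ltn_ord j; lia.
  exists q; split; rewrite ?qy //.
  by rewrite -[RHS]/(y 0) -qy //; apply: act_ext => j.
pose Y i : A n.+3 := if i <= n.+1 then y i else
  if i == n.+3 then act (om_lastdeg n.+1) (sval x : A n.+2) else cA (sval x : A n.+2).
have Yle i : i <= n.+1 -> Y i = y i by rewrite /Y => ->.
have Yd : Y n.+3 = act (om_lastdeg n.+1) (sval x : A n.+2).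
  by rewrite /Y eqxx ifF //; lia.
have Yc : Y n.+4 = cA (sval x : A n.+2).
  by rewrite /Y !ifF //; lia.
have xE i : i <= n.+1 -> sval (dface i x) = dface i (sval x : A n.+2).
  exact: dface_slice.
have [||q qY] := inner_fill qA (k := n.+2) (y := Y); first by lia.
  move=> i j /= ik jk ij lej; have [lej1|gtj] := leqP j n.+1.
    rewrite !Yle; [|lia|lia].
    case: n => [|n] in x y cy yE Y Yle Yd Yc xE ik jk lej lej1 *.
      have [-> ->] : i = 0 /\ j = 1 by lia.
      have dE (z : Z 0) : dface 0 (z : A 3) = act (om_last3 0) (z : A 3).
        by apply: act_ext => k.
      by have [_ _ y0w] := yE 0 isT; have [_ _ y1w] := yE 1 isT; rewrite !dE y0w y1w.
    have := cy i j isT isT ij lej1.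
    by rewrite !dface_Dec //; lia.
  have [lei|gti] := leqP i n.+1; last first.
    have -> : i = n.+3 by lia.
    have -> : j = n.+4 by lia.
    rewrite Yd Yc cA_last /dface -act_comp -[LHS](@act_id A); apply: act_ext => k /=.
    by rewrite /bump; have := ltn_ord k; lia.
  have [yc yd _] := yE i lei; rewrite (Yle i) //.
  have [->|->] : j = n.+3 \/ j = n.+4 by lia.
    rewrite Yd /= yd xE // /dface -!act_comp; apply: act_ext => k /=.
    by rewrite /bump; lia.
  by rewrite Yc /= yc xE // cA_dface //; lia.
exists q; split=> [|i lei]; last first.
  by rewrite -Yle // -qY; [rewrite !dface_Dec //; lia|lia|lia].
split; rewrite ?qY ?Yc ?Yd //; try lia.
have [_ _ <-] := yE 0 isT; rewrite -Yle // -qY; [|lia|lia].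
by rewrite /dface -act_comp; apply: act_ext => j.
Qed.

Lemma joyal_terminal_of_retraction : joyal_terminal t.
Proof.
have [Q QE] := retraction_cells.
apply/joyal_terminalP => -[|n] y cy yt.
  exists (cA (y 1)); case=> [|[|//]] _; last exact: cA_last.
  rewrite act00 in yt; rewrite yt -[RHS](proj2_sig (c 0 (y 1))); apply: act_ext => j.
  by rewrite [j]ord1.
have y_ends i : i <= n.+1 -> @ends_at A t n (y i).
  case: i => [//|i] lei; rewrite /ends_at -yt.
  transitivity (act (om_const 0 ord_max) (dface 0 (y i.+1))).
    by rewrite /dface -act_comp; apply: act_ext => j.
  rewrite (cy 0 i.+1) //=; last by lia.
  rewrite /dface -act_comp; apply: act_ext => j /=.
  by rewrite /bump; lia.
(* Indices beyond n+1 default to face 0. *)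
pose sl i : slice t n := if pselect (i <= n.+1) is left lei then exist _ (y i) (y_ends i lei)
  else exist _ (y 0) (y_ends 0 isT).
have slE i : i <= n.+1 -> sval (sl i) = y i by rewrite /sl; case: pselect.
pose q i : A n.+3 := Q n (sl i).
have [qc qd qw] : [/\ forall i, i <= n.+1 -> dface n.+3 (q i) = cA (y i),
    forall i, i <= n.+1 -> dface n.+2 (q i) = act (om_lastdeg n) (y i) &
    forall i, act (om_last3 n) (q i) = w].
  by split=> i *; have [qc qd qw] := QE n (sl i); rewrite -?slE.
have q_dface i j : i < j -> j <= n.+1 -> dface i (q j) = dface j.-1 (q i).
  move=> ij lej; rewrite /q; case: n => [|n] in y cy yt y_ends sl slE q qc qd qw lej *.
    have [-> ->] : i = 0 /\ j = 1 by lia.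
    have dE (z : A 3) : dface 0 z = act (om_last3 0) z by apply: act_ext => k.
    by rewrite !dE; have := qw 0; have := qw 1; rewrite /q => -> ->.
  have QD k l : k <= n.+1 -> dface k (Q n.+1 (sl l) : A n.+4) = Q n (dface k (sl l)).
    by move=> lek; rewrite sapp_dface !dface_Dec //; lia.
  rewrite !QD; [|lia|lia]; congr (Q n _); apply: slice_inj.
  rewrite !dface_slice; [|lia|lia]; rewrite !slE; [|lia|lia].
  by apply: cy => //; lia.
(* An inner horn in (b_0, .., b_{n+1}, t', t''), missing the face opposite t'; its other faces are
   the [q i] with [t] omitted, and [c] applied to the face of the sphere opposite [t]. *)
pose Y i : A n.+2 := if i <= n.+1 then dface n.+1 (q i) else cA (y n.+2).
have Yle i : i <= n.+1 -> Y i = dface n.+1 (q i) by rewrite /Y => ->.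
have Yc : Y n.+3 = cA (y n.+2) by rewrite /Y ifF //; lia.
have [||a aY] := inner_fill qA (k := n.+2) (y := Y); first by lia.
  move=> i j /= ik jk ij lej; have [lej1|gtj] := leqP j n.+1.
    rewrite !Yle; [|lia|lia].
    rewrite [LHS](@dface_dface A _ i n.+1); last by lia.
    rewrite [RHS](@dface_dface A _ j.-1 n.+1); last by lia.
    by rewrite q_dface.
  have -> : j = n.+3 by lia.
  have lei : i <= n.+1 by lia.
  rewrite Yc Yle //= cA_dface; last by lia.
  by rewrite -[RHS](@dface_dface A _ n.+1 n.+3) // qc // cA_dface // cy //; lia.
exists (dface n.+2 a) => i; rewrite leq_eqVlt => /orP [/eqP->|lei].
  rewrite -[LHS](@dface_dface A _ n.+2 n.+3) // aY; [|lia..].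
  by rewrite Yc cA_last.
rewrite [LHS](@dface_dface A _ i n.+2) //= aY; [|lia..].
rewrite Yle //.
rewrite -(@dface_dface A _ n.+1 n.+2) // qd // /dface -act_comp -[RHS](@act_id A).
apply: act_ext => j /=.
by rewrite /bump; have := ltn_ord j; lia.
Qed.
End Retraction.

Lemma adjunction_joyal_terminal (A : qcat) (t : qcarrier A 0) :
  adjunction (qfunctor (A := A) (B := qpt) (bang A)) (qfunctor (A := qpt) (B := A) (yoneda t)) ->
  joyal_terminal t.
Proof.
set f := qfunctor (A := A) (B := qpt) (bang A); set u := qfunctor (A := qpt) (B := A) (yoneda t).
move=> [eta [eps [_ /(congr1 (@pack _ _ _))]]].
have eps1 : pack eps = pack (idm (comp1_ob f u)).
  by apply: pack_thin; apply: sexp_pt_thin.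
rewrite (pack_compm_idr _ (pack_eq_hom _)) (pack_compm_idr _ (pack_whiskl_id _ eps1)).
rewrite (pack_compm_idr _ (pack_eq_hom _)) (pack_compm_idl _ (pack_eq_hom _)).
set v : Delta 0 0 := om_id 0; rewrite pack_whiskr_qCat2 => /(pack_fmap (hmap (sev A v))) eta_u.
(* Evaluating the triangle identity at the point shows that the component of [eta] at [t] is the
   identity in [h A]. *)
have ev_u : sev A t = scomp (@sprecomp (Delta 0) A A u) (sev A v).
  by apply: smap_ext => n F /=; congr (F n (act _ _, _)); apply: om0_eq.
have := congr1 (fun F : functor (h (sexp A A)) _ => pack (fmap F eta))
  (etrans (congr1 (fun k => hmap k) ev_u) (hmap_comp _ _)).
rewrite [RHS]eta_u fmap1 {eta_u}; elim/hhom_ind: eta => p; rewrite hmap_hclass => p_id.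
(* The constant cone at [t] lifts the target of [eta]; lifting back along [p] reaches a section over
   the identity. *)
have cone_ends n : @ends_at A t n (act (om_const n.+1 ord0) t).
  by rewrite /ends_at -act_comp act00.
pose cone n : slice t n := exist _ (act (om_const n.+1 ord0) t) (cone_ends n).
have cone_act m n (g : ordmap m n) (_ : A n) : cone m = act g (cone n).
  by apply: slice_inj; rewrite /= -act_comp; congr act; apply: om0_eq.
pose gl : smap A (slice t) := @SMap A (slice t) (fun n _ => cone n) cone_act.
have [|c [cK c_tri]] := @lift_path A t (@qcatP A) A _ _ p gl.
  move=> n x /=; rewrite /dface -act_comp; congr act; exact: om0_eq.
have vu : hmap (sev A v) u = t by apply: act00.
have := triangle_along_id (@qcatP A) p_id (c_tri t); rewrite vu.
move=> /(@triangle_degen A (@qcatP A) t _) [w [w2 _ w1]].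
exact: (joyal_terminal_of_retraction (@qcatP A) (c := c) _ w2 w1).
Qed.

Theorem proposition4p4p7 (A : qcat) (t : qcarrier A 0) :
  joyal_terminal t <->
  adjunction (qfunctor (A := A) (B := qpt) (bang A)) (qfunctor (A := qpt) (B := A) (yoneda t)).
Proof.
by split; [apply: joyal_terminal_adjunction | apply: adjunction_joyal_terminal].
Qed.
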